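(* Let $K\in\mathbb{R}$ and $m>0$. Suppose that the pointwise curvature-dimension condition $$\Gamma_2(f)\geq K\,\Gamma(f)+\frac1m(Lf)^2\quad\text{on } M,\ \text{for every } f\in C^\infty(M),$$ holds. Then the integral form curvature-dimension condition holds with the same $K$ and $m$: for every $f\in C^\infty(M)$ taking values in $\mathcal{I}$, $$\int_M \bigg[\frac{2\,\Gamma_2(\Phi'(f))}{\Phi''(f)}-\bigg(\frac1{\Phi''}\bigg)''(f)\,\big(\Phi''(f)\Gamma(f)\big)^2\bigg]\,d\mu\ \geq\ 2K\,q_\Phi(f)+\frac{2\,(q_\Phi(f))^2}{m\,C_\Phi(f)}.$$
   Context: $M$ is an $n$-dimensional compact Riemannian manifold without boundary, $dx$ its Riemannian volume measure, $\Delta$ the Laplace–Beltrami operator and $\nabla$ the gradient. $V\in C^\infty(M)$ is normalized so that $d\mu=e^{V(x)}\,dx$ is a probability measure. $L=\Delta+\nabla V\cdot\nabla$, which is symmetric with respect to $\mu$. $\Gamma(f,g)=\frac12\big(L(fg)-fLg-gLf\big)=\nabla f\cdot\nabla g$ and $\Gamma_2(f,g)=\frac12\big[L\Gamma(f,g)-\Gamma(Lf,g)-\Gamma(f,Lg)\big]=\langle\mathrm{Hess}_f,\mathrm{Hess}_g\rangle_{HS}+(\mathrm{Ric}-\mathrm{Hess}_V)(\nabla f,\nabla g)$, with $\Gamma(f)=\Gamma(f,f)$ and $\Gamma_2(f)=\Gamma_2(f,f)$. Here $\langle\cdot,\cdot\rangle_{HS}$ is the Hilbert–Schmidt inner product.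 $\Phi:\mathcal{I}\to\mathbb{R}$ is a smooth convex function on an interval $\mathcal{I}\subset\mathbb{R}$ such that $\Phi''$ and $-1/\Phi''$ are also convex (so in particular $\Phi''>0$). For $f\in C^\infty(M)$ with values in $\mathcal{I}$, $$q_\Phi(f)=\int_M\Phi''(f)\,\Gamma(f)\,d\mu,\qquad C_\Phi(f)=\int_M f^2\,\Phi''(f)\,d\mu.$$ Convention: if $C_\Phi(f)=0$ (which forces $f\equiv0$ and $q_\Phi(f)=0$), the term $(q_\Phi(f))^2/C_\Phi(f)$ is read as $0$. *)

(* Defs.v *)
From HB Require Import structures.
From mathcomp Require Import all_boot all_order all_algebra.
From mathcomp Require Import all_classical all_reals all_analysis.

Set Implicit Arguments.
Unset Strict Implicit.
Unset Printing Implicit Defensive.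

Import Order.TTheory GRing.Theory Num.Theory.
Import numFieldNormedType.Exports.

Local Open Scope classical_set_scope.
Local Open Scope ring_scope.

Section lebesgue_step.
Context (R : realType) (n : nat).
Variable mu : {sigma_finite_measure set (n.-tuple R) -> \bar R}.

Definition tuple_of_pair (x : R * n.-tuple R) : n.+1.-tuple R :=
  [tuple of x.1 :: x.2].

Lemma measurable_tuple_of_pair : measurable_fun setT tuple_of_pair.
Proof. by apply: measurable_cons; [exact: measurable_fst|exact: measurable_snd]. Qed.

Definition lebesgue_step : set (n.+1.-tuple R) -> \bar R :=
  pushforward (lebesgue_measure \x mu)%E tuple_of_pair.

Let step0 : lebesgue_step set0 = 0%E.
Proof. by rewrite /lebesgue_step /pushforward preimage_set0 measure0. Qed.

Let step_ge0 A : (0 <= lebesgue_step A)%E.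
Proof. by rewrite /lebesgue_step /pushforward measure_ge0. Qed.

Let step_semi_sigma_additive : semi_sigma_additive lebesgue_step.
Proof.
move=> F mF tF mUF; rewrite /lebesgue_step /pushforward preimage_bigcup.
apply: measure_semi_sigma_additive.
- by move=> i; rewrite -[X in measurable X]setTI;
    exact: measurable_tuple_of_pair.
- apply/trivIsetP => i j _ _ ij; rewrite -preimage_setI.
  by move/trivIsetP : tF => /(_ _ _ _ _ ij) ->//; rewrite preimage_set0.
- rewrite -preimage_bigcup -[X in measurable X]setTI.
  exact: measurable_tuple_of_pair.
Qed.

HB.instance Definition _ := isMeasure.Build _ _ _ lebesgue_step
  step0 step_ge0 step_semi_sigma_additive.

Let step_sigma_finite : sigma_finite setT lebesgue_step.
Proof.
pose leb : {sigma_finite_measure set (measurableTypeR R) -> \bar R} :=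
  @lebesgue_measure R.
have /sigma_finiteP[F [TF ndF Foo]] := sigma_finiteT leb.
have /sigma_finiteP[G [TG ndG Goo]] := sigma_finiteT mu.
pose g (t : n.+1.-tuple R) := (thead t, [tuple of behead t]).
have mg : measurable_fun setT g.
  by apply: measurable_fun_pair => /=;
    [exact: measurable_tnth|exact: measurable_behead].
exists (fun k => g @^-1` (F k `*` G k)).
  apply/esym; rewrite -subTset => t _.
  have [i _ Fi] : (\bigcup_k F k) (g t).1 by rewrite -TF.
  have [j _ Gj] : (\bigcup_k G k) (g t).2 by rewrite -TG.
  exists (maxn i j) => //; split.
  - by move: Fi; exact/subsetPset/ndF/leq_maxl.
  - by move: Gj; exact/subsetPset/ndG/leq_maxr.
move=> k; have [mF Fk] := Foo k; have [mG Gk] := Goo k; split.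
  by rewrite -[X in measurable X]setTI; apply: mg => //; exact: measurableX.
rewrite [ltLHS](_ : _ = (leb \x mu)%E (F k `*` G k)).
  by rewrite product_measure1E// lte_mul_pinfty// ge0_fin_numE.
rewrite /lebesgue_step /pushforward.
have gK x : g (tuple_of_pair x) = x.
  by case: x => x t; congr pair; exact: val_inj.
suff -> : tuple_of_pair @^-1` (g @^-1` (F k `*` G k)) = F k `*` G k by [].
by rewrite -comp_preimage (_ : g \o _ = id) //; exact/funext.
Qed.

HB.instance Definition _ := Measure_isSigmaFinite.Build _ _ _ lebesgue_step
  step_sigma_finite.

End lebesgue_step.

(** Lebesgue measure on [R^n], points being encoded as [n]-tuples because these
    are the ones that carry a measurable structure; [row_of_tuple] transports
    them to ['rV[R]_n], which carries the differential structure. *)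
Fixpoint lebesgue_measure_tuple (R : realType) (n : nat) :
    {sigma_finite_measure set (n.-tuple R) -> \bar R} :=
  match n with
  | 0 => \d_([tuple] : 0.-tuple R)
  | k.+1 => lebesgue_step (lebesgue_measure_tuple R k)
  end.

Definition row_of_tuple (R : realType) (n : nat) (t : n.-tuple R) : 'rV[R]_n :=
  \row_k tnth t k.

Definition partial (R : realType) (n : nat) (k : 'I_n) (f : 'rV[R]_n -> R)
    : 'rV[R]_n -> R :=
  fun x => 'D_(delta_mx 0 k : 'rV[R]_n) f x.

Fixpoint Cr_on (R : realType) (n r : nat) (U : set 'rV[R]_n)
    (f : 'rV[R]_n -> R) : Prop :=
  match r with
  | 0 => forall x, U x -> {for x, continuous f}
  | r'.+1 => (forall x, U x -> differentiable f x) /\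
             (forall k, Cr_on r' U (partial k f))
  end.

(** Meant for open [U]. *)
Definition smooth_on (R : realType) (n : nat) (U : set 'rV[R]_n)
    (f : 'rV[R]_n -> R) : Prop :=
  forall r, Cr_on r U f.

(** [coord i] and [param i] are only meaningful on [dom i] and on its image.
    [chart_at] records the covering of [M] by the charts, together with a choice
    of a chart around each point. *)
Record smooth_atlas (R : realType) (n : nat) (M : ptopologicalType) := {
  chart : Type ;
  dom : chart -> set M ;
  coord : chart -> M -> 'rV[R]_n ;
  param : chart -> 'rV[R]_n -> M ;
  chart_at : M -> chart ;
  dom_chart_at : forall p, dom (chart_at p) p ;
  dom_open : forall i, open (dom i) ;
  coord_open : forall i, open (coord i @` dom i) ;
  coordK : forall i p, dom i p -> param i (coord i p) = p ;
  coord_continuous : forall i p, dom i p -> {for p, continuous (coord i)} ;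
  param_continuous : forall i x, (coord i @` dom i) x ->
    {for x, continuous (param i)} ;
  transition_smooth : forall i j k,
    smooth_on (coord i @` (dom i `&` dom j))
              (fun x => coord j (param i x) 0 k)
}.

(** [metric i x] is the Gram matrix of the coordinate frame of the chart [i] at
    the point of coordinates [x]; [metric_change] says that these matrices are
    the components of a single (0,2)-tensor. *)
Record riemannian_metric (R : realType) (n : nat) (M : ptopologicalType)
    (A : smooth_atlas R n M) := {
  metric : chart A -> 'rV[R]_n -> 'M[R]_n ;
  metric_smooth : forall i a b,
    smooth_on (coord i @` dom i) (fun x => metric i x a b) ;
  metric_sym : forall i x, (coord i @` dom i) x ->
    (metric i x)^T = metric i x ;
  metric_pos : forall i x (v : 'rV[R]_n), (coord i @` dom i) x -> v != 0 ->
    0 < (v *m metric i x *m v^T) 0 0 ;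
  metric_change : forall i j x, (coord i @` (dom i `&` dom j)) x ->
    let y := fun z => coord j (param i z) in
    let J := \matrix_(a, b) partial a (fun z => y z 0 b) x in
    metric i x = J *m metric j (y x) *m J^T
}.

Section riemannian_geometry.
Context (R : realType) (n : nat) (M : ptopologicalType).
Context (A : smooth_atlas R n M) (g : riemannian_metric A).

Definition local_expr (i : chart A) (f : M -> R) : 'rV[R]_n -> R :=
  fun x => f (param i x).

Definition smooth_fun (f : M -> R) : Prop :=
  forall i : chart A, smooth_on (coord i @` dom i) (local_expr i f).

(** Components in the chart [i] of the gradient, [g^{ab} d_b f]. *)
Definition gradient (i : chart A) (f : M -> R) (x : 'rV[R]_n) : 'rV[R]_n :=
  (\row_b partial b (local_expr i f) x) *m invmx (metric g i x).

Definition inner (i : chart A) (x u v : 'rV[R]_n) : R :=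
  (u *m metric g i x *m v^T) 0 0.

Definition volume_density (i : chart A) (x : 'rV[R]_n) : R :=
  Num.sqrt (\det (metric g i x)).

Definition divergence (i : chart A) (X : 'rV[R]_n -> 'rV[R]_n) (x : 'rV[R]_n)
    : R :=
  (volume_density i x)^-1 *
  \sum_a partial a (fun y => volume_density i y * X y 0 a) x.

Definition grad_dot (f h : M -> R) (p : M) : R :=
  let i := chart_at A p in
  let x := coord i p in
  inner i x (gradient i f x) (gradient i h x).

Definition laplace_beltrami (f : M -> R) (p : M) : R :=
  let i := chart_at A p in divergence i (gradient i f) (coord i p).

Definition weighted_laplacian (V f : M -> R) (p : M) : R :=
  laplace_beltrami f p + grad_dot V f p.

End riemannian_geometry.

Definition Gamma (R : realType) (M : Type) (L : (M -> R) -> M -> R)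
    (f h : M -> R) (p : M) : R :=
  2^-1 * (L (fun q => f q * h q) p - f p * L h p - h p * L f p).

Definition Gamma2 (R : realType) (M : Type) (L : (M -> R) -> M -> R)
    (f h : M -> R) (p : M) : R :=
  2^-1 * (L (Gamma L f h) p - Gamma L (L f) h p - Gamma L f (L h) p).

Definition borel (M : ptopologicalType) := g_sigma_algebraType (@open M).

(** The Riemannian volume is the Borel measure whose density with respect to
    Lebesgue measure is [sqrt (det g)] in every chart. *)
Definition is_riemannian_volume (R : realType) (n : nat) (M : ptopologicalType)
    (A : smooth_atlas R n M) (g : riemannian_metric A)
    (vol : {measure set (borel M) -> \bar R}) : Prop :=
  forall (i : chart A) (B : set (borel M)), measurable B -> B `<=` dom i ->
    vol B = (\int[lebesgue_measure_tuple R n]_(t in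
               [set t | (coord i @` B) (row_of_tuple t)])
               (volume_density g i (row_of_tuple t))%:E)%E.

(** Derivative relatively to [I], hence one-sided at the endpoints of an
    interval. *)
Definition derive_within (R : realType) (I : set R) (f : R -> R) (x : R) : R :=
  lim ((y - x)^-1 * (f y - f x) @[y --> within (I `\ x) (nbhs x)]).

Definition derivable_within (R : realType) (I : set R) (f : R -> R) (x : R)
    : Prop :=
  cvg ((y - x)^-1 * (f y - f x) @[y --> within (I `\ x) (nbhs x)]).

Definition derive_within_n (R : realType) (I : set R) (r : nat) (f : R -> R)
    : R -> R :=
  iter r (derive_within I) f.

Definition smooth_within (R : realType) (I : set R) (f : R -> R) : Prop :=
  forall r x, I x -> derivable_within I (derive_within_n I r f) x.

(** The non-degeneracy clause is needed for derivatives on [I] to make sense,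
    and [0 < Phi''] for [1 / Phi''] to be meaningful. *)
Record admissible (R : realType) (I : set R) (Phi : R -> R) : Prop := {
  adm_interval : is_interval I ;
  adm_nondegenerate : exists a b, [/\ I a, I b & a < b] ;
  adm_smooth : smooth_within I Phi ;
  adm_convex : convex_function (I : set R^o) (Phi : R^o -> R^o) ;
  adm_pos : forall x, I x -> 0 < derive_within_n I 2 Phi x ;
  adm_convex2 :
    convex_function (I : set R^o) (derive_within_n I 2 Phi : R^o -> R^o) ;
  adm_convexV : convex_function (I : set R^o)
    ((fun x => - (derive_within_n I 2 Phi x)^-1) : R^o -> R^o)
}.

Section phi_functionals.
Context (R : realType) (M : ptopologicalType).
Variables (mu : {measure set (borel M) -> \bar R}).
Variables (L : (M -> R) -> M -> R) (I : set R) (Phi : R -> R).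

Definition q_Phi (f : M -> R) : R :=
  \int[mu]_p (derive_within_n I 2 Phi (f p) * Gamma L f f p).

(** A quotient by [C_Phi f] is [0] when [C_Phi f = 0], since [0^-1 = 0]. *)
Definition C_Phi (f : M -> R) : R :=
  \int[mu]_p ((f p) ^+ 2 * derive_within_n I 2 Phi (f p)).

End phi_functionals.

(* Main.v *)
(** Put h = Phi'(f). The pointwise condition applied to h, together with
    Gamma(h) = Phi''(f)^2 Gamma(f) and (1/Phi'')'' <= 0, bounds the integrand
    from below by 2 K Phi''(f) Gamma(f) + (2/m) (L h)^2 / Phi''(f). Integration by
    parts gives int f L h dmu = - int Gamma(f, h) dmu = - q(f), and Cauchy-Schwarz
    gives q(f)^2 <= C(f) int (L h)^2 / Phi''(f) dmu.

    Integrability follows from the continuity of all integrands on the compact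
    manifold, which requires that L be independent of the chart. This is obtained
    from the weak formulation: in every chart, L is e^{-V} (det g)^{-1/2} times a
    Euclidean divergence, so for u of class C^1 with compact support in the chart
    the integral of u L f + Gamma(f, u) vanishes by Fubini and the fundamental
    theorem of calculus. Global integration by parts then follows with a C^1
    partition of unity. *)

Require Import Defs.
From mathcomp Require Import all_boot all_order perm all_algebra.
From mathcomp Require Import all_classical all_reals all_analysis.
From mathcomp Require Import measurable_realfun ring lra.

Set Implicit Arguments.
Unset Strict Implicit.
Unset Printing Implicit Defensive.

Import Order.TTheory GRing.Theory Num.Theory.
Import numFieldNormedType.Exports.

Local Open Scope classical_set_scope.
Local Open Scope ring_scope.

Local Notation coord := Defs.coord.

(** * Differential calculus on open subsets of R^n *)

(** [weighted_laplacian] evaluates each point in the chart that [chart_at] happens to choose there,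
    with no regularity of the choice, so even the continuity of [L f] is a theorem. The classical
    route differentiates the transformation laws of the metric and of its determinant. Here only
    first-order invariance is computed by hand ([dot_transition]), and second-order invariance is
    deduced by duality: two charts give candidates for [L f] with the same integrals against test
    functions supported in their overlap, and [mu] charges every nonempty open set. Such test
    functions need only be C^1, which permits piecewise polynomial bumps.

    The other obstacle is that [I] may contain its endpoints, where derivatives are one-sided. At a
    given point, a function with a derivative relative to [I] agrees on [I] with a function having
    an ordinary derivative there. As [f] takes its values in [I], this is enough for the chain rule,
    one point at a time. *)

Lemma near_eq_differentiable (R : numFieldType) (V W : normedModType R)
    (f h : V -> W) (x : V) :
  (\near x, f x = h x) -> differentiable f x -> differentiable h x.
Proof.
move=> fh df; have fhx := nbhs_singleton fh.
have [cdf eqf] := (diff_locallyP x f).1 df.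
have eqh : h \o shift x = cst (h x) + 'd f x +o_ 0 id.
  apply/eqaddoP => e e0; move/eqaddoP : eqf => /(_ e e0) Hf.
  have fh' : \forall y \near 0, f (y + x) = h (y + x).
    by move: fh; rewrite (near_shift 0) subr0.
  by apply: filterS2 fh' Hf => y /=; rewrite !fctE /= -fhx => ->.
have dh := diff_unique cdf eqh.
by apply/diff_locallyP; rewrite dh.
Qed.

Section Cr.
Context (R : realType) (n : nat).
Implicit Types (U : set 'rV[R]_n) (f h : 'rV[R]_n -> R).

Lemma partial_near_eq (k : 'I_n) f h (x : 'rV[R]_n) :
  (\near x, f x = h x) -> partial k f x = partial k h x.
Proof. by move=> fh; rewrite /partial; exact: near_eq_derive. Qed.

Lemma open_near_eq U f h (x : 'rV[R]_n) : open U -> U x ->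
  (forall y, U y -> f y = h y) -> \near x, f x = h x.
Proof.
move=> oU Ux fh; near=> y; apply: fh; near: y; exact: open_nbhs_nbhs.
Unshelve. all: by end_near. Qed.

(** [Cr_on] constrains total functions at the points of [U] only; since [U] is open, agreement on
    [U] transfers all derivatives. A derivative can thus be replaced by a formula valid only on [U],
    which is how the inductions on [r] below proceed. *)
Lemma Cr_on_eq U r f h : open U -> (forall x, U x -> f x = h x) ->
  Cr_on r U f -> Cr_on r U h.
Proof.
move=> oU; elim: r f h => [|r IH] f h fh /=.
  move=> cf x Ux; have fhx := open_near_eq oU Ux fh.
  have : h y @[y --> x] --> f x.
    by apply: cvg_trans (cf x Ux); exact: (near_eq_cvg (F := nbhs x) fhx).
  by rewrite (fh x Ux).
move=> [df Cf]; split=> [x Ux|k].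
  by apply: near_eq_differentiable (df x Ux); exact: open_near_eq oU Ux fh.
apply: IH (Cf k) => x Ux; apply: partial_near_eq.
exact: open_near_eq oU Ux fh.
Qed.

Lemma Cr_onS U r f : Cr_on r.+1 U f -> Cr_on r U f.
Proof.
elim: r f => [|r IH] f; first by move=> [df _] x Ux; exact/differentiable_continuous/df.
by move=> [df Cf]; split=> // k; exact: IH.
Qed.

Lemma Cr_on_continuous U r f : Cr_on r U f -> forall x, U x -> {for x, continuous f}.
Proof. by elim: r => [//|r IH] /Cr_onS. Qed.

Lemma Cr_on_cst U r (c : R) : Cr_on r U (fun=> c).
Proof.
elim: r c => [|r IH] c /=; first by move=> x Ux; exact: cst_continuous.
split=> [x _|k]; first exact: differentiable_cst.
rewrite (_ : partial k _ = fun=> 0); first exact: IH.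
by apply/funext => x; rewrite /partial derive_cst.
Qed.

Lemma Cr_onD U r f h : open U -> Cr_on r U f -> Cr_on r U h ->
  Cr_on r U (fun x => f x + h x).
Proof.
move=> oU; elim: r f h => [|r IH] f h /=.
  by move=> cf ch x Ux; exact: continuousD (cf x Ux) (ch x Ux).
move=> [df Cf] [dh Ch]; split=> [x Ux|k].
  by apply: differentiableD; [exact: df|exact: dh].
apply: Cr_on_eq (IH _ _ (Cf k) (Ch k)) => // x Ux.
by rewrite /partial deriveD//; apply: diff_derivable; [exact: df|exact: dh].
Qed.

Lemma partialD (k : 'I_n) f h (x : 'rV[R]_n) :
  differentiable f x -> differentiable h x ->
  partial k (fun y => f y + h y) x = partial k f x + partial k h x.
Proof. by move=> df dh; rewrite /partial -deriveD//; exact: diff_derivable. Qed.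

Lemma partialM (k : 'I_n) f h (x : 'rV[R]_n) :
  differentiable f x -> differentiable h x ->
  partial k (fun y => f y * h y) x = f x * partial k h x + partial k f x * h x.
Proof.
move=> df dh; rewrite /partial deriveM; [|exact: diff_derivable..].
by rewrite /GRing.scale /= [h x * _]mulrC.
Qed.

Lemma Cr_onM U r f h : open U -> Cr_on r U f -> Cr_on r U h ->
  Cr_on r U (fun x => f x * h x).
Proof.
move=> oU; elim: r f h => [|r IH] f h /=.
  by move=> cf ch x Ux; exact: continuousM (cf x Ux) (ch x Ux).
move=> Cf Ch; have [df Cfk] := Cf; have [dh Chk] := Ch; split=> [x Ux|k].
  by apply: differentiableM; [exact: df|exact: dh].
apply: (@Cr_on_eq _ _ (fun x => f x * partial k h x + partial k f x * h x)) => //.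
  by move=> x Ux; rewrite partialM//; [exact: df|exact: dh].
by apply: Cr_onD => //; apply: IH => //; exact: Cr_onS.
Qed.

Lemma Cr_onN U r f : open U -> Cr_on r U f -> Cr_on r U (fun x => - f x).
Proof.
move=> oU Cf; apply: (@Cr_on_eq _ _ (fun x => -1 * f x)) => //.
  by move=> x _; rewrite mulN1r.
by apply: Cr_onM => //; exact: Cr_on_cst.
Qed.

Lemma Cr_on_sum U r (J : Type) (s : seq J) (P : pred J) (F : J -> 'rV[R]_n ->
    R) : open U ->
  (forall j, P j -> Cr_on r U (F j)) -> Cr_on r U (fun x => \sum_(j <- s | P j) F j x).
Proof.
move=> oU CF; elim: s => [|j s IH].
  by apply: Cr_on_eq (Cr_on_cst _ _ 0) => // x _; rewrite big_nil.
have [Pj|Pj] := boolP (P j); last first.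
  by apply: Cr_on_eq IH => // x _; rewrite big_cons (negbTE Pj).
by apply: Cr_on_eq (Cr_onD oU (CF j Pj) IH) => // x _; rewrite big_cons Pj.
Qed.

Lemma Cr_on_prod U r (J : Type) (s : seq J) (P : pred J) (F : J -> 'rV[R]_n ->
    R) : open U ->
  (forall j, P j -> Cr_on r U (F j)) -> Cr_on r U (fun x => \prod_(j <- s | P j) F j x).
Proof.
move=> oU CF; elim: s => [|j s IH].
  by apply: Cr_on_eq (Cr_on_cst _ _ 1) => // x _; rewrite big_nil.
have [Pj|Pj] := boolP (P j); last first.
  by apply: Cr_on_eq IH => // x _; rewrite big_cons (negbTE Pj).
by apply: Cr_on_eq (Cr_onM oU (CF j Pj) IH) => // x _; rewrite big_cons Pj.
Qed.

Lemma partial_comp1 (k : 'I_n) (phi : R -> R) (l : R) f (x : 'rV[R]_n) :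
  differentiable f x -> is_derive (f x) 1 phi l ->
  differentiable (phi \o f) x /\ partial k (phi \o f) x = l * partial k f x.
Proof.
move=> df dphi; have dphi' : differentiable phi (f x).
  by apply/derivable1_diffP; exact: ex_derive.
have dc : differentiable (phi \o f) x by exact: differentiable_comp.
split=> //; rewrite /partial !deriveE// diff_comp//= deriv1E;
    last exact/derivable1_diffP.
by rewrite derive1E (derive_val (is_derive := dphi)) mulrC.
Qed.

End Cr.

(** * Derivatives relative to a set, reduced to ordinary derivatives *)

Section derivative_within.
Context (R : realType).
Implicit Types (I : set R) (phi psi : R -> R) (x l : R).

Definition is_derive_within I phi x l : Prop :=
  (y - x)^-1 * (phi y - phi x) @[y --> within (I `\ x) (nbhs x)] --> l.

(* At an endpoint of [I] this extends [phi] linearly beyond [I]. *)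
Lemma is_derive_within_extension I phi x l : I x -> is_derive_within I phi x l ->
  exists psi, is_derive x 1 psi l /\ forall y, I y -> psi y = phi y.
Proof.
move=> Ix dphi.
pose psi y := if y \in I then phi y else phi x + l * (y - x).
have psiI y : I y -> psi y = phi y by move=> Iy; rewrite /psi mem_set.
exists psi; split => //.
suff cl : h^-1 *: (psi (h%:A + x) - psi x) @[h --> 0^'] --> l.
  by apply: DeriveDef; [apply/cvg_ex; exists l|exact: cvg_lim].
apply/cvgrPdist_lt => e e0; move/cvgrPdist_lt : dphi => /(_ e e0) dphi.
have {}dphi : \forall h \near 0, (I `\ x) (h + x) ->
    `|l - (h + x - x)^-1 * (phi (h + x) - phi x)| < e.
  have {}dphi : \forall y \near x, (I `\ x) y ->
      `|l - (y - x)^-1 * (phi y - phi x)| < e by exact: dphi.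
  by move: dphi; rewrite (near_shift 0) subr0.
rewrite /dnbhs /within /=; apply: filterS dphi => h /= H h0.
rewrite (psiI x Ix) /GRing.scale /= mulr1.
rewrite /psi; case: ifPn => [/set_mem Ih|_].
  have := H _; rewrite addrK; apply; split=> //= /eqP.
  by rewrite -subr_eq0 addrK; exact/negP.
by rewrite addrAC subrr add0r addrK mulrC mulfK// subrr normr0.
Qed.

(** Converse of the extension lemma. Rules of calculus relative to [I] follow from the ordinary
    rules by passing to extensions and back, so endpoints are never a separate case. *)
Lemma is_derive_is_derive_within I phi psi x l : I x -> is_derive x 1 psi l ->
  (forall y, I y -> psi y = phi y) -> is_derive_within I phi x l.
Proof.
move=> Ix [dpsi <-] psiI;
    have dl : h^-1 *: (psi (h%:A + x) - psi x) @[h --> 0^'] --> 'D_1 psi x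
    by exact: dpsi.
apply/cvgrPdist_lt => e e0; move/cvgrPdist_lt : dl => /(_ e e0).
rewrite /dnbhs /within /= => dl.
have {}dl : \forall h \near 0, h != 0 ->
    `|'D_1 psi x - h^-1 *: (psi (h%:A + x) - psi x)| < e by exact: dl.
have {dl} : \forall y \near x, y - x != 0 ->
    `|'D_1 psi x - (y - x)^-1 *: (psi ((y - x)%:A + x) - psi x)| < e.
  by rewrite (near_shift 0) subr0 /=; apply: filterS dl => h; rewrite /= addrK.
apply: filterS => y Hy [Iy /eqP yx]; have := Hy _; rewrite subr_eq0 => /(_ yx).
by rewrite /GRing.scale /= mulr1 subrK !psiI.
Qed.

(** [f] never leaves [I], so [phi] may be exchanged for its extension adapted to the value [f x],
    even if that value is an endpoint of [I]. *)
Lemma differentiable_comp_within (n : nat) (I : set R) phi l (f : 'rV[R]_n ->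
    R) (x : 'rV[R]_n) :
  (forall y, I (f y)) -> differentiable f x -> is_derive_within I phi (f x) l ->
  differentiable (phi \o f) x.
Proof.
move=> If df /(is_derive_within_extension (If x))[psi [[dpsi _] psiI]].
rewrite (_ : phi \o f = psi \o f); last by apply/funext => y /=; rewrite psiI.
by apply: differentiable_comp => //; exact/derivable1_diffP.
Qed.

Lemma partial_comp_within (n : nat) (k : 'I_n) (I : set R) phi l (f : 'rV[R]_n ->
    R) (x : 'rV[R]_n) :
  (forall y, I (f y)) -> differentiable f x -> is_derive_within I phi (f x) l ->
  partial k (phi \o f) x = l * partial k f x.
Proof.
move=> If df /(is_derive_within_extension (If x))[psi [dpsi psiI]].
rewrite (_ : phi \o f = psi \o f); last by apply/funext => y /=; rewrite psiI.
by have [_ ->] := partial_comp1 k df dpsi.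
Qed.

End derivative_within.

Lemma continuous_rV (R : realType) (T : topologicalType) (n : nat)
    (y : T -> 'rV[R]_n) (x : T) :
  (forall c, {for x, continuous (fun z => y z 0 c)}) -> {for x, continuous y}.
Proof.
move=> cy A [B Bx BA].
have H : \forall z \near x, forall j, B 0 j (y z 0 j).
  by apply: filter_forall => j; apply: (cy j); exact: Bx.
by apply: filterS H => z Hz; apply: BA => i j; rewrite ord1.
Qed.

Section chain_rule.
Context (R : realType) (m n : nat).
Implicit Types (f : 'rV[R]_n -> R) (y : 'rV[R]_m -> 'rV[R]_n).

Lemma differentiable_rV y (x : 'rV[R]_m) :
  (forall c, differentiable (fun z => y z 0 c) x) -> differentiable y x.
Proof.
move=> dy; rewrite (_ : y = \sum_c (fun z => y z 0 c *: delta_mx 0 c)).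
  by apply: differentiable_sum => c; exact: differentiableZl.
by apply/funext => z; rewrite {1}[y z]row_sum_delta fct_sumE.
Qed.

Lemma partial_comp f y (x : 'rV[R]_m) (b : 'I_m) :
  (forall c, differentiable (fun z => y z 0 c) x) -> differentiable f (y x) ->
  partial b (f \o y) x =
  \sum_c partial b (fun z => y z 0 c) x * partial c f (y x).
Proof.
move=> dy df; have dy' := differentiable_rV dy.
have dc : differentiable (f \o y) x by exact: differentiable_comp.
rewrite /partial deriveE// diff_comp//= -(deriveE _ dy').
rewrite derive_mx; last exact: diff_derivable.
rewrite [X in 'd f _ X]row_sum_delta linear_sum; apply: eq_bigr => c _ /=.
by rewrite linearZ /= mxE -deriveE.
Qed.

Lemma Cr_on_comp r f y (U : set 'rV[R]_m) (W : set 'rV[R]_n) :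
  open U -> (forall x, U x -> W (y x)) ->
  (forall c, Cr_on r U (fun z => y z 0 c)) -> Cr_on r W f -> Cr_on r U (f \o y).
Proof.
move=> oU UW; elim: r f => [|r IH] f.
  move=> cy cf x Ux; apply: continuous_comp; last exact/cf/UW.
  by apply: continuous_rV => c; exact: cy.
move=> Cy [df Cf]; split=> [x Ux|b].
  apply: differentiable_comp; last exact/df/UW.
  by apply: differentiable_rV => c; have [dc _] := Cy c; exact: dc.
apply: (@Cr_on_eq _ _ _ _ (fun x => \sum_c partial b (fun z =>
    y z 0 c) x * partial c f (y x))) => //.
  move=> x Ux; rewrite partial_comp//; last exact/df/UW.
  by move=> c; have [dc _] := Cy c; exact: dc.
apply: Cr_on_sum => // c _; apply: Cr_onM => //.
  by have [_ pc] := Cy c; exact: pc.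
by apply: IH; [move=> c'; exact: Cr_onS|exact: Cf].
Qed.
End chain_rule.

(** * Stability of class C^r under inverses, roots, exponentials and determinants *)

Section Cr2.
Context (R : realType) (n : nat).
Implicit Types (U : set 'rV[R]_n) (f h : 'rV[R]_n -> R).

(** The derivative of the inverse is a product of inverses of [f] and a derivative of [f], all of
    class C^r by induction. The lemmas on [Num.sqrt] and [expR] close their inductions in the same
    way. *)
Lemma Cr_onV U r f : open U -> (forall x, U x -> f x != 0) -> Cr_on r U f ->
  Cr_on r U (fun x => (f x)^-1).
Proof.
move=> oU f0; elim: r => [|r IH] /=.
  by move=> cf x Ux; apply: continuousV; [exact: f0|exact: cf].
move=> Cf; have [df Cfk] := Cf; split=> [x Ux|k].
  by apply: differentiableV; [exact: df|exact: f0].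
apply: (@Cr_on_eq _ _ _ _ (fun x => - ((f x)^-1 * (f x)^-1) * partial k f x)) => //.
  move=> x Ux; rewrite /partial deriveV//; [|exact: f0|by apply: diff_derivable;
      exact: df].
  by rewrite expr2 invfM.
have CV := IH (Cr_onS Cf).
by apply: Cr_onM => //; apply: Cr_onN => //; exact: Cr_onM.
Qed.

Lemma Cr_on_sqrt U r f : open U -> (forall x, U x -> 0 < f x) -> Cr_on r U f ->
  Cr_on r U (fun x => Num.sqrt (f x)).
Proof.
move=> oU f0; elim: r => [|r IH].
  move=> cf x Ux; apply: (@continuous_comp _ _ _ f); first exact: cf.
  exact: sqrt_continuous.
move=> Cf; have [df Cfk] := Cf.
have H k x : U x -> differentiable (Num.sqrt \o f) x /\
    partial k (Num.sqrt \o f) x = (2 * @Num.sqrt R (f x))^-1 * partial k f x.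
  by move=> Ux; apply: partial_comp1; [exact: df|apply: is_derive1_sqrt; exact: f0].
split=> [x Ux|k].
  apply: differentiable_comp; first exact: df.
  have := is_derive1_sqrt (f0 x Ux); move=> [+ _]; exact: (derivable1_diffP _ _).1.
apply: (@Cr_on_eq _ _ _ _ (fun x => (2 * @Num.sqrt R (f x))^-1 * partial k f x)) => //.
  by move=> x Ux; have [_ ->] := H k x Ux.
apply: Cr_onM (Cfk k) => //; apply: (@Cr_onV _ _ (fun x => 2 * Num.sqrt (f x))) => //.
  by move=> x Ux; rewrite mulf_neq0// gt_eqF// sqrtr_gt0 f0.
by apply: Cr_onM => //; [exact: Cr_on_cst|exact/IH/Cr_onS].
Qed.

Lemma Cr_on_expR U r f : open U -> Cr_on r U f -> Cr_on r U (fun x => expR (f x)).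
Proof.
move=> oU; elim: r => [|r IH].
  move=> cf x Ux; apply: (@continuous_comp _ _ _ f); first exact: cf.
  exact: continuous_expR.
move=> Cf; have [df Cfk] := Cf.
have H k x : U x -> differentiable (expR \o f) x /\
    partial k (expR \o f) x = expR (f x) * partial k f x.
  by move=> Ux; apply: partial_comp1; exact: df.
split=> [x Ux|k].
  apply: differentiable_comp; first exact: df.
  exact/derivable1_diffP/derivable_expR.
apply: (@Cr_on_eq _ _ _ _ (fun x => expR (f x) * partial k f x)) => //.
  by move=> x Ux; have [_ ->] := H k x Ux.
by apply: Cr_onM (Cfk k) => //; exact/IH/Cr_onS.
Qed.

Lemma Cr_on_det U r p (B : 'rV[R]_n -> 'M[R]_p) : open U ->
  (forall a b, Cr_on r U (fun x => B x a b)) -> Cr_on r U (fun x => \det (B x)).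
Proof.
move=> oU CB; apply: (@Cr_on_eq _ _ _ _ (fun x =>
    \sum_(s : {perm 'I_p}) (-1) ^+ s * \prod_i B x i (s i))) => //.
apply: Cr_on_sum => // s _; apply: Cr_onM => //; first exact: Cr_on_cst.
exact: Cr_on_prod.
Qed.

(** Cramer's rule: the entries are cofactors divided by the determinant. *)
Lemma Cr_on_invmx U r p (B : 'rV[R]_n -> 'M[R]_p) : open U ->
  (forall x, U x -> B x \in unitmx) ->
  (forall a b, Cr_on r U (fun x => B x a b)) ->
  forall a b, Cr_on r U (fun x => invmx (B x) a b).
Proof.
move=> oU Bu CB a b.
apply: (@Cr_on_eq _ _ _ _ (fun x => (\det (B x))^-1 * cofactor (B x) b a)) => //.
  by move=> x Ux; rewrite /invmx Bu// !mxE.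
apply: Cr_onM => //.
  apply: Cr_onV => //; last exact: Cr_on_det.
  by move=> x /Bu; rewrite unitmxE unitfE.
apply: Cr_onM => //; first exact: Cr_on_cst.
apply: Cr_on_det => // i j.
by apply: Cr_on_eq (CB (lift b i) (lift a j)) => // x _; rewrite !mxE.
Qed.
End Cr2.

(** * Lebesgue integration on R^n *)

Section tuple_measure.
Context (R : realType).

(** For positive [r], the balls of the sup norm of ['rV[R]_n], read on tuples, where the measure
    lives. *)
Definition tuple_box (n : nat) (c : n.-tuple R) (r : R) : set (n.-tuple R) :=
  [set t | forall j, `]tnth c j - r, tnth c j + r[%classic (tnth t j)].

Lemma measurable_tuple_box n (c : n.-tuple R) r : measurable (tuple_box c r).
Proof.
rewrite (_ : tuple_box c r = \bigcap_(j in [set: 'I_n])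
    ((fun t => tnth t j) @^-1` `]tnth c j - r, tnth c j + r[)).
  apply: fin_bigcap_measurable => // j _; rewrite -[X in measurable X]setTI.
  by apply: measurable_tnth => //; exact: measurable_itv.
by apply/seteqP; split => [t H j _|t H j]; [exact: H|exact: H].
Qed.

(** The measurable structure on tuples comes from the coordinates, not from a topology. An open set
    is a countable union of cubes with rational centres and half-sides, and each cube is a finite
    intersection of preimages under coordinates. *)
Lemma measurable_row_of_tuple_open n (O : set 'rV[R]_n) :
  open O -> measurable (@row_of_tuple R n @^-1` O).
Proof.
move=> oO.
pose F (cr : n.-tuple rat * rat) : set (n.-tuple R) :=
  let B := tuple_box [tuple ratr (tnth cr.1 j) | j < n] (ratr cr.2) in
  if pselect (B `<=` @row_of_tuple R n @^-1` O) then B else set0.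
have -> : @row_of_tuple R n @^-1` O = \bigcup_cr F cr.
  apply/seteqP; split=> [t Ot|t [cr _]]; last by rewrite /F; case: pselect => // BO /BO.
  have /nbhs_ballP[e /= e0 eO] : nbhs (row_of_tuple t) O by exact: open_nbhs_nbhs.
  (* A cube of half-side [q < e / 2] whose centre is within [q] of [t] contains [t], and all its
     points are within [e] of [t]. *)
  have [q /itvP q0e] : exists q, ratr q \in `]0, (e / 2)[.
    by apply: rat_in_itvoo; rewrite divr_gt0.
  have hc (j : 'I_n) : exists c : rat, ratr c \in `](tnth t j - ratr q),
      (tnth t j + ratr q)[.
    by apply: rat_in_itvoo; rewrite ltrBlDr -addrA ltrDl addr_gt0// q0e.
  pose c := [tuple sval (cid (hc j)) | j < n].
  have tB : tuple_box [tuple ratr (tnth c j) | j < n] (ratr q) t.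
    move=> j; rewrite !tnth_mktuple; case: cid => x /=; rewrite !in_itv /= => /andP[].
    by move=> ? ?; apply/andP; split; lra.
  exists (c, q) => //; rewrite /F; case: pselect => //= BnO; exfalso; apply: BnO.
  move=> s Bs; apply: eO; split=> // i j; rewrite !mxE.
  have := tB j; have := Bs j;
      rewrite !tnth_mktuple /= !in_itv /= => /andP[? ?] /andP[? ?].
  have q0 : 0 < ratr q :> R by rewrite q0e.
  have qe : ratr q < e / 2 :> R by rewrite q0e.
  by rewrite -ball_normE /= ltr_norml; apply/andP; split; lra.
apply: countable_bigcupT_measurable => // -[c q]; rewrite /F.
by case: pselect => ?; [exact: measurable_tuple_box|exact: measurable0].
Qed.

(** [phi] leads from a measurable space to the topological space on which [h] is continuous: it is
    [row_of_tuple] for tuples, and the identity from [borel M] to [M] on the manifold. *)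
Lemma measurable_fun_continuous_on d (X : measurableType d) (T : topologicalType)
    (phi : X -> T) (U : set T) (h : T -> R) :
  (forall O : set T, open O -> measurable (phi @^-1` O)) -> open U ->
  (forall x, U x -> {for x, continuous h}) -> measurable_fun (phi @^-1` U) (h \o phi).
Proof.
move=> mphi oU ch; apply: (measurability _ (RGenOpens.measurableE R)).
move=> _ [_ [a [b ->]] <-].
rewrite -[X in measurable X]/(phi @^-1` (U `&` h @^-1` `]a, b[%classic)); apply: mphi;
    rewrite openE => x [Ux hx].
have : nbhs x (h @^-1` `]a, b[) by apply: (ch x Ux); apply: open_nbhs_nbhs; split=> //;
    exact: interval_open.
by apply: filterI; exact: open_nbhs_nbhs.
Qed.

Lemma lebesgue_measure_tuple_box n (c : n.-tuple R) r : 0 < r ->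
  lebesgue_measure_tuple R n (tuple_box c r) = ((2 * r) ^+ n)%:E.
Proof.
move=> r0; elim: n c => [|n IH] c /=.
  by rewrite diracE mem_set//= => -[].
rewrite /lebesgue_step /pushforward.
have -> : @tuple_of_pair R n @^-1` tuple_box c r =
    `](thead c - r), (thead c + r)[ `*` tuple_box [tuple of behead c] r.
  apply/seteqP; split=> [[x t] H|[x t] [/= H1 H2] j].
    split; first by have := H ord0; rewrite /tuple_of_pair (tuple_eta c) !tnth0.
    move=> j; have := H (lift ord0 j).
    by rewrite /tuple_of_pair {1 2}(tuple_eta c) !tnthS.
  rewrite /tuple_of_pair (tuple_eta c); case: (unliftP ord0 j) => [k ->|->].
    by rewrite !tnthS; exact: H2.
  by rewrite !tnth0.
rewrite product_measure1E//; last exact: measurable_tuple_box.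
rewrite IH [X in (X * _)%E](_ : _ = lebesgue_measure [set` `](thead c - r),
    (thead c + r)[])//.
rewrite lebesgue_measure_itv /= lte_fin ifT; last by lra.
by rewrite -EFinD -EFinM exprS; congr EFin; congr (_ * _); lra.
Qed.

(** Continuity bounds [h] on the compact cube of half-side [B], hence everywhere. As [tuple_box] is
    open, the cube of half-side [B + 1] is used to contain the support; its measure is finite. *)
Lemma integrable_compact_support n (h : 'rV[R]_n -> R) (B : R) : 0 < B ->
    continuous h ->
  (forall (x : 'rV[R]_n) j, B < `|x 0 j| -> h x = 0) ->
  (lebesgue_measure_tuple R n).-integrable setT (EFin \o (h \o @row_of_tuple R n)).
Proof.
move=> B0 ch h0.
have mh : measurable_fun setT (h \o @row_of_tuple R n).
  rewrite -(preimage_setT (@row_of_tuple R n));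
      apply: measurable_fun_continuous_on => //.
    by move=> O; exact: measurable_row_of_tuple_open.
  - exact: openT.
  - by move=> x _; exact: ch.
pose K : set 'rV[R]_n := [set v | forall j, `[-B, B]%classic (v 0 j)].
have cK : compact K by apply: (@rV_compact _ _ (fun=> `[-B, B]%classic)) => j;
    exact: segment_compact.
have [M [_ HM]] : bounded_set (h @` K).
  by apply: compact_bounded; apply: continuous_compact => //;
      exact: continuous_subspaceT.
have hM x : `|h x| <= `|M| + 1.
  have [Kx|nKx] := pselect (K x).
    by apply: HM; [rewrite (le_lt_trans (ler_norm M))// ltrDl|exists x].
  move/existsNP : nKx => [j]; rewrite /= in_itv /= -ler_norml => /negP;
      rewrite -ltNge => Bj.
  by rewrite (h0 _ _ Bj) normr0 addr_ge0.
pose z : n.-tuple R := [tuple 0 | j < n].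
have -> : h \o @row_of_tuple R n = (h \o @row_of_tuple R n) \_ (tuple_box z (B + 1)).
  apply/funext => t; rewrite patchE; case: ifPn => // /negP; rewrite inE => nb.
  move/existsNP : nb => [j];
      rewrite tnth_mktuple /= in_itv /= sub0r add0r -ltr_norml => /negP.
  rewrite -leNgt => Bj; rewrite /= (h0 _ j)// mxE.
  by apply: lt_le_trans Bj; rewrite ltrDl.
have mb := measurable_tuple_box z (B + 1).
rewrite -restrict_EFin; apply/(integrable_mkcond _ mb).
apply: (@measurable_bounded_integrable _ _ _ (lebesgue_measure_tuple R n)) => //.
- by move: (ltry ((2 * (B + 1)) ^+ n));
    rewrite -(lebesgue_measure_tuple_box z)// addr_gt0.
- exact: measurable_funTS.
- exists (`|M| + 1); split; first exact: num_real.
  by move=> y yM t _ /=; rewrite (le_trans (hM _))// ltW.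
Qed.

End tuple_measure.

(** * Integration against a measure given by a density in a parametrization *)

Section density.
Import HBNNSimple.

(** The formula assumed for sets is the case of indicator functions; it passes to simple functions
    by linearity and to [h] by monotone convergence on both sides. It serves with [nu] equal to
    [vol], and then to [mu]. *)
Lemma ge0_integral_density d1 d2 (X : measurableType d1) (Y : measurableType d2)
    (R : realType) (lam : {measure set X -> \bar R}) (nu : {measure set Y -> \bar R})
    (phi : X -> Y) (D : set X) (E : set Y) (w : X -> R) :
  measurable D -> measurable E -> measurable_fun D phi -> (forall x, D x ->
      E (phi x)) ->
  measurable_fun D w -> (forall x, D x -> 0 <= w x) ->
  (forall B, measurable B -> B `<=` E ->
     nu B = (\int[lam]_(x in D `&` phi @^-1` B) (w x)%:E)%E) ->
  forall h : Y -> R, measurable_fun E h -> (forall y, E y -> 0 <= h y) ->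
  (\int[nu]_(y in E) (h y)%:E = \int[lam]_(x in D) (h (phi x) * w x)%:E)%E.
Proof.
move=> mD mE mphi DE mw w0 nuE h mh h0.
have mEh : measurable_fun E (EFin \o h) by exact/measurable_EFinP.
pose f_ := nnsfun_approx mE mEh.
have mfphi n : measurable_fun D (f_ n \o phi).
  apply: (measurable_comp measurableT) => //; exact: measurable_funP.
transitivity (limn (fun n => \int[nu]_(y in E) (f_ n y)%:E)%E).
  rewrite -monotone_convergence//.
  - apply: eq_integral => y /[!inE] yD; apply/esym/cvg_lim => //.
    by apply: cvg_nnsfun_approx=> // z Ez; rewrite lee_fin h0.
  - by move=> n; exact/measurable_EFinP/measurable_funP.
  - by move=> n y _; rewrite lee_fin.
  - by move=> y _ m n mn; rewrite lee_fin; exact/lefP/nd_nnsfun_approx.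
rewrite [X in limn X](_ : _ =
    (fun n => \int[lam]_(x in D) (f_ n (phi x) * w x)%:E)%E).
  rewrite -monotone_convergence//.
  - apply: eq_integral => x /[!inE] Dx; apply/cvg_lim => //.
    rewrite EFinM; under eq_fun do rewrite EFinM.
    apply: cvgeZr => //.
    by apply: cvg_nnsfun_approx => [z Ez|]; [rewrite lee_fin h0|exact: DE].
  - by move=> n; apply/measurable_EFinP; exact: measurable_funM (mfphi n) mw.
  - by move=> n x Dx; rewrite lee_fin mulr_ge0// w0.
  - move=> x Dx m n mn; rewrite lee_fin ler_wpM2r ?w0//.
    exact/lefP/nd_nnsfun_approx.
apply/funext => n.
have mfk k : measurable (f_ n @^-1` [set k]) by exact: measurable_funPTI.
(* Both integrals are sums over the finitely many values [k] of the simple function, and the assumed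
   formula applies to each level set. *)
transitivity (\sum_(k \in range (f_ n))
    \int[lam]_(x in D) (k * \1_(f_ n @^-1` [set k]) (phi x) * w x)%:E)%E.
  under eq_integral do rewrite fimfunE -fsumEFin//.
  rewrite ge0_integral_fsum//; last 2 first.
  - by move=> y; exact/measurable_EFinP/measurable_funM.
  - by move=> y x _; rewrite nnfun_muleindic_ge0.
  apply: eq_fsbigr => k kf.
  have k0 : 0 <= k by move: kf; rewrite inE => -[y _ <-].
  under [RHS]eq_integral do rewrite -mulrA EFinM.
  have mind : measurable_fun D (fun x => \1_(f_ n @^-1` [set k]) (phi x) * w x).
    by apply: measurable_funM => //; apply: (measurable_comp measurableT).
  rewrite ge0_integralZl//; last 2 first.
  - exact/measurable_EFinP.
  - by move=> x Dx; rewrite lee_fin mulr_ge0// w0.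
  rewrite integralZl_indic_nnsfun//; congr (_ * _)%E.
  rewrite integral_indic// nuE; last 2 first.
  - exact: measurableI.
  - by move=> y [].
  rewrite preimage_setI setIA setIAC (_ : D `&` phi @^-1` E = D); last first.
    by apply/setIidPl => x /DE.
  rewrite integral_mkcondr; apply: eq_integral => x _.
  rewrite /= patchE indicE (_ : (x \in _) = (phi x \in f_ n @^-1` [set k])).
    by case: ifPn => _; rewrite ?mul1r ?mul0r.
  by apply/idP/idP; rewrite !inE.
rewrite -ge0_integral_fsum//.
- apply: eq_integral => x _; rewrite fsumEFin// -mulr_fsuml -?fimfunE//.
- move=> k; apply/measurable_EFinP; apply: measurable_funM => //.
  apply: measurable_funM => //.
  by apply: (measurable_comp measurableT) => //.
- by move=> k x Dx; rewrite lee_fin mulr_ge0 ?w0//;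
    have := nnfun_muleindic_ge0 (f_ n) k (phi x); rewrite -EFinM lee_fin.
Qed.

End density.

Section cons_row.
Context (R : realType) (n : nat).

(** The counterpart on rows of [tuple_of_pair]; through it Fubini's theorem is read on functions of
    rows. *)
Definition cons_row (x : R) (v : 'rV[R]_n) : 'rV[R]_n.+1 :=
  \row_k oapp (fun j => v 0 j) x (unlift ord0 k).

Lemma cons_row0 x v : cons_row x v 0 ord0 = x.
Proof. by rewrite mxE unlift_none. Qed.

Lemma cons_rowS x v j : cons_row x v 0 (lift ord0 j) = v 0 j.
Proof. by rewrite mxE liftK. Qed.

Lemma row_of_tuple_pair (p : R * n.-tuple R) :
  row_of_tuple (tuple_of_pair p) = cons_row p.1 (row_of_tuple p.2).
Proof.
apply/rowP => k; rewrite mxE; case: (unliftP ord0 k) => [j|] ->.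
  by rewrite cons_rowS mxE /tuple_of_pair tnthS; congr tnth; exact: val_inj.
by rewrite cons_row0.
Qed.

Lemma cons_row_shift0 (h x : R) v :
  cons_row (h + x) v = h *: delta_mx 0 ord0 + cons_row x v.
Proof.
apply/rowP => k; rewrite !mxE; case: (unliftP ord0 k) => [j|] -> /=.
  by rewrite mulr0 add0r.
by rewrite mulr1.
Qed.

Lemma cons_row_shiftS (h x : R) v (j : 'I_n) :
  cons_row x (h *: delta_mx 0 j + v) = h *: delta_mx 0 (lift ord0 j) + cons_row x v.
Proof.
apply/rowP => k; rewrite !mxE; case: (unliftP ord0 k) => [i|] -> /=.
  by rewrite !mxE eqxx /= (inj_eq (@lift_inj _ ord0)).
by rewrite mulr0 add0r.
Qed.

Lemma continuous_cons_row_l v : continuous (cons_row ^~ v).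
Proof.
move=> x; apply: continuous_rV => c; case: (unliftP ord0 c) => [j ->|->].
  have H : continuous (fun z => cons_row z v 0 (lift ord0 j)); last exact: H.
    by under eq_fun do rewrite cons_rowS; move=> y; exact: cst_continuous.
have H : continuous (fun z => cons_row z v 0 ord0); last exact: H.
by under eq_fun do rewrite cons_row0; move=> y; exact: cvg_id.
Qed.

Lemma continuous_cons_row_r x : continuous (cons_row x).
Proof.
move=> v; apply: continuous_rV => c; case: (unliftP ord0 c) => [j ->|->].
  have H : continuous (fun z => cons_row x z 0 (lift ord0 j)); last exact: H.
    by under eq_fun do rewrite cons_rowS; exact: coord_continuous.
have H : continuous (fun z => cons_row x z 0 ord0); last exact: H.
by under eq_fun do rewrite cons_row0; move=> y; exact: cst_continuous.
Qed.

Variable w : 'rV[R]_n.+1 -> R.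

(** The difference quotients of the slice and of [w] are the same function of the increment, so no
    chain rule is involved. *)
Lemma derivable_cons_row_l x v : derivable w (cons_row x v) (delta_mx 0 ord0) ->
  derivable (fun y => w (cons_row y v)) x 1 /\
  derive1 (fun y => w (cons_row y v)) x = partial ord0 w (cons_row x v).
Proof.
move=> dw.
have E : (fun h : R => h^-1 *: (w (cons_row (h%:A + x) v) - w (cons_row x v))) =
    (fun h : R => h^-1 *: (w (h *: delta_mx 0 ord0 + cons_row x v) - w (cons_row x v))).
  by apply/funext => h; rewrite /GRing.scale /= mulr1 cons_row_shift0.
by rewrite derive1E /partial /derive /derivable /= E.
Qed.

Lemma derivable_cons_row_r x v j : derivable w (cons_row x v) (delta_mx 0
    (lift ord0 j)) ->
  derivable (fun u => w (cons_row x u)) v (delta_mx 0 j) /\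
  partial j (fun u => w (cons_row x u)) v = partial (lift ord0 j) w (cons_row x v).
Proof.
move=> dw.
have E : (fun h : R => h^-1 *: (w (cons_row x (h *: delta_mx 0 j
    + v)) - w (cons_row x v))) =
    (fun h : R => h^-1 *: (w (h *: delta_mx 0 (lift ord0 j)
        + cons_row x v) - w (cons_row x v))).
  by apply/funext => h; rewrite cons_row_shiftS.
by rewrite /partial /derive /derivable /= E.
Qed.

End cons_row.

(** * Vanishing integrals of partial derivatives *)

Section integral_partial.
Context (R : realType).

(** The strict inequality defines an open set, so [w] vanishes in a whole neighbourhood of [x]. *)
Lemma partial_support n (w : 'rV[R]_n -> R) (a : 'I_n) (B : R) :
  (forall (x : 'rV[R]_n) j, B < `|x 0 j| -> w x = 0) ->
  forall (x : 'rV[R]_n) j, B < `|x 0 j| -> partial a w x = 0.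
Proof.
move=> w0 x j Bx; have -> : partial a w x = partial a (fun=> 0) x.
  apply: partial_near_eq.
  have cn : {for x, continuous (fun y : 'rV[R]_n => `|y 0 j|)}.
    apply: (@continuous_comp _ _ _ (fun y : 'rV[R]_n => y 0 j));
        first exact: coord_continuous.
    exact: norm_continuous.
  have H : \forall y \near x, B < `|(y : 'rV[R]_n) 0 j| by exact: (cvgr_gt _ cn).
  by apply: filterS H => y; exact: w0.
by rewrite /partial derive_cst.
Qed.

Lemma integral_derive_compact_support (F f : R -> R) (B : R) : 0 < B ->
  (forall x, derivable F x 1) -> derive1 F =1 f -> continuous f ->
  (forall x, B < `|x| -> F x = 0) -> (forall x, B < `|x| -> f x = 0) ->
  (\int[lebesgue_measure]_x (f x)%:E = 0)%E.
Proof.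
move=> B0 dF Ff cf F0 f0.
have cF : continuous F by move=> x; apply/differentiable_continuous/derivable1_diffP.
(* [F] vanishes strictly beyond [B], so the interval of integration is enlarged until its endpoints
   lie there. *)
pose b := B + 1; have Bb : B < b by rewrite ltrDl.
have -> : (\int[lebesgue_measure]_x (f x)%:E = \int[lebesgue_measure]_(x in `[(- b)%R,
    b]) (f x)%:E)%E.
  rewrite [RHS]integral_mkcond; apply: eq_integral => x _; rewrite patchE.
  case: ifPn => //; rewrite notin_setE /= in_itv /= -ler_norml => /negP;
      rewrite -ltNge => bx.
  by rewrite f0// (lt_trans Bb).
have b0 : 0 < b by rewrite addr_gt0.
rewrite (continuous_FTC2 (F := F)).
- by rewrite !F0 ?subee// ?normrN gtr0_norm.
- by lra.
- exact: continuous_subspaceT.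
- split; first by move=> x _; exact: dF.
    by apply: cvg_at_right_filter; exact: cF.
  by apply: cvg_at_left_filter; exact: cF.
- by move=> x _; exact: Ff.
Qed.

(** Induction on the dimension through Fubini's theorem. If [a] is the first coordinate, the inner
    integral is one-dimensional and vanishes by the fundamental theorem of calculus; otherwise each
    slice at a fixed first coordinate is an instance of the induction hypothesis. Derivability is
    asked in the direction [a] alone, a condition that slices inherit directly. *)
Lemma integral_partial n (a : 'I_n) (w : 'rV[R]_n -> R) (B : R) : 0 < B ->
  (forall x, derivable w x (delta_mx 0 a)) -> continuous (partial a w) ->
  (forall (x : 'rV[R]_n) j, B < `|x 0 j| -> w x = 0) ->
  (\int[lebesgue_measure_tuple R n]_t (partial a w (row_of_tuple t))%:E = 0)%E.
Proof.
move=> B0; elim: n => [|n IH] in a w *; first by case: a.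
move=> dw cw w0; have pw0 := partial_support a w0.
have iw := integrable_compact_support B0 cw pw0.
pose h t := (partial a w (row_of_tuple t))%:E.
have mtp := @measurable_tuple_of_pair R n.
have mh : measurable_fun setT h by exact: measurable_int iw.
pose leb : {sigma_finite_measure set (measurableTypeR R) ->
    \bar R} := @lebesgue_measure R.
pose P := (leb \x lebesgue_measure_tuple R n)%E.
have ih : P.-integrable setT (h \o @tuple_of_pair R n).
  apply/integrableP; split; first exact: measurableT_comp.
  move/integrableP : iw => [_]; rewrite /= /lebesgue_step.
  rewrite ge0_integral_pushforward//.
  have mah : measurable_fun setT (abse \o h) by exact: measurableT_comp.
  exact: mah.
have -> : (\int[lebesgue_measure_tuple R n.+1]_t h t = \int[P]_p
    (h \o @tuple_of_pair R n) p)%E.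
  by rewrite /= /lebesgue_step integral_pushforward.
have hE x t : (h \o @tuple_of_pair R n) (x,
    t) = (partial a w (cons_row x (row_of_tuple t)))%:E.
  by rewrite /h /= row_of_tuple_pair.
case: (unliftP ord0 a) => [j aj|a0].
  rewrite -(integral12_prod_meas1 ih) integral0_eq// => x _.
  rewrite aj in dw cw w0 hE.
  have dwx v := derivable_cons_row_r (dw (cons_row x v)).
  have pE v := (dwx v).2.
  rewrite /fubini_F (eq_integral (fun t => (partial j (fun u =>
      w (cons_row x u)) (row_of_tuple t))%:E)); last first.
    by move=> t _; rewrite hE pE.
  apply: IH.
  - by move=> v; exact: (dwx v).1.
  - have -> : partial j (fun u =>
      w (cons_row x u)) = partial (lift ord0 j) w \o cons_row x.
      by apply/funext => v; rewrite /= pE.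
    by move=> v; apply: continuous_comp; [exact: continuous_cons_row_r|exact: cw].
  - by move=> v k Bv; apply: (w0 _ (lift ord0 k)); rewrite cons_rowS.
rewrite -(integral21_prod_meas1 ih) integral0_eq// => t _.
rewrite a0 in dw cw w0 pw0 hE.
rewrite /fubini_G (eq_integral (fun x : measurableTypeR R =>
    (partial ord0 w (cons_row x (row_of_tuple t)))%:E)); last first.
  by move=> x _; rewrite hE.
have cG (v : 'rV[R]_n) : continuous (fun x : R => partial ord0 w (cons_row x v)).
  by move=> x; apply: continuous_comp; [exact: continuous_cons_row_l|exact: cw].
apply: (@integral_derive_compact_support (fun x =>
    w (cons_row x (row_of_tuple t))) _ B) => //.
- by move=> x; have [] := derivable_cons_row_l (dw (cons_row x (row_of_tuple t))).
- by move=> x; have [] := derivable_cons_row_l (dw (cons_row x (row_of_tuple t))).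
- by move=> x Bx; apply: (w0 _ ord0); rewrite cons_row0.
- by move=> x Bx; apply: (pw0 _ ord0); rewrite cons_row0.
Qed.

End integral_partial.

(** * Riemannian geometry in charts *)

Section positive_definite.
Context (R : realType) (p : nat).
Implicit Type G : 'M[R]_p.

Definition posdef G := forall v : 'rV[R]_p, v != 0 -> 0 < (v *m G *m v^T) 0 0.

Lemma posdef_det_neq0 G : posdef G -> \det G != 0.
Proof.
move=> Gpos; apply/negP => /det0P[v v0 vG].
by have := Gpos v v0; rewrite vG mul0mx mxE ltxx.
Qed.

Lemma posdef1 : posdef 1%:M.
Proof.
move=> v v0; rewrite mulmx1 mxE; have [k vk] : exists k, v 0 k != 0.
  apply/existsP; apply: contraNT v0 => /existsPn v0; apply/eqP/rowP => k.
  by rewrite mxE; have /negbNE/eqP := v0 k.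
rewrite (bigD1 k)//= mxE ltr_pwDl//; first by rewrite -expr2 exprn_even_gt0.
by apply: sumr_ge0 => j _; rewrite mxE -expr2 sqr_ge0.
Qed.

(* The determinant does not vanish along the segment from [1%:M] to [G]. *)
Lemma posdef_det_gt0 G : posdef G -> 0 < \det G.
Proof.
move=> Gpos.
(* Along the segment the determinant is a polynomial in [t], hence continuous, which is what the
   intermediate value theorem requires. *)
pose P : 'M[{poly R}]_p := (1 - 'X) *: 1%:M + 'X *: map_mx polyC G.
have PE t : (\det P).[t] = \det ((1 - t) *: 1%:M + t *: G).
  rewrite -[LHS]/(horner_eval t (\det P)) -det_map_mx; congr (\det _).
  apply/matrixP => a b; rewrite !mxE /= /horner_eval !hornerE.
  by rewrite hornerMn hornerC.
have Pt t : 0 <= t <= 1 -> (\det P).[t] != 0.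
  move=> /andP[t0 t1]; rewrite PE; apply: posdef_det_neq0 => v v0.
  have -> : (v *m ((1 - t) *: 1%:M + t *: G) *m v^T) 0 0 =
      (1 - t) * (v *m 1%:M *m v^T) 0 0 + t * (v *m G *m v^T) 0 0.
    by rewrite mulmxDr mulmxDl -!scalemxAr -!scalemxAl !mxE.
  have := posdef1 v0; have := Gpos v v0.
  move: ((v *m G *m _) 0 0) ((v *m 1%:M *m _) 0 0) => a b a0 b0.
  have [->|t00] := eqVneq t 0; first by rewrite subr0 mul1r mul0r addr0.
  have tp : 0 < t by rewrite lt_neqAle eq_sym t00.
  by rewrite ltr_wpDl// ?mulr_gt0// mulr_ge0 ?subr_ge0// ltW.
have P0 : (\det P).[0] = 1 by rewrite PE subr0 scale1r scale0r addr0 det1.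
have P1 : (\det P).[1] = \det G by rewrite PE subrr scale0r add0r scale1r.
rewrite ltNge; apply/negP => detG.
have [||c] := @IVT R (horner (\det P)) 0 1 0 ler01.
- by apply: continuous_subspaceT; exact: continuous_horner.
- by rewrite P0 P1 ge_min le_max detG ler01 orbT.
- by rewrite in_itv /= => /Pt /[swap] ->; rewrite eqxx.
Qed.

End positive_definite.

(** * Functions of class C^r on the manifold *)

Section charts.
Context (R : realType) (n : nat) (M : ptopologicalType).
Context (A : smooth_atlas R n M).
Implicit Types (i j : chart A) (f h : M -> R).

Definition cdom i : set 'rV[R]_n := coord i @` dom i.

Lemma open_cdom i : open (cdom i). Proof. exact: coord_open. Qed.

Lemma cdom_coord i p : dom i p -> cdom i (coord i p).
Proof. by move=> ip; exists p. Qed.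

Lemma dom_param i x : cdom i x -> dom i (param i x).
Proof. by move=> [p ip <-]; rewrite coordK. Qed.

Lemma paramK i x : cdom i x -> coord i (param i x) = x.
Proof. by move=> [p ip <-]; rewrite coordK. Qed.

Lemma coord_imageE i (O : set M) :
  coord i @` (dom i `&` O) = cdom i `&` (param i @^-1` O).
Proof.
apply/seteqP; split=> [_ [p [ip Op] <-]|x [ix Ox]].
  by split; [exact: cdom_coord|rewrite /= coordK].
by exists (param i x); [split=> //; exact: dom_param|exact: paramK].
Qed.

Lemma open_coord_image i (O : set M) : open O -> open (coord i @` (dom i `&` O)).
Proof.
move=> oO; rewrite coord_imageE openE => x [ix Ox].
apply: filterI; first by apply: open_nbhs_nbhs; split=> //; exact: open_cdom.
by apply: param_continuous => //; exact: open_nbhs_nbhs.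
Qed.

(** Finite regularity is kept alongside [smooth_fun] because the test functions built from [bump]
    are only of class C^1. *)
Definition Cr_fun r f := forall i, Cr_on r (cdom i) (local_expr i f).

Lemma smooth_Cr_fun r f : smooth_fun A f -> Cr_fun r f.
Proof. by move=> sf i; exact: sf. Qed.

Lemma continuous_at_coord i f (F : 'rV[R]_n -> R) p : dom i p ->
  (forall q, dom i q -> f q = F (coord i q)) -> {for coord i p, continuous F} ->
  {for p, continuous f}.
Proof.
move=> ip fF cF.
have cFc : {for p, continuous (F \o coord i)}.
  by apply: continuous_comp; [exact: Defs.coord_continuous|exact: cF].
have near_fF : {near p, F \o coord i =1 f}.
  have : nbhs p (dom i) by apply: open_nbhs_nbhs; split=> //; exact: dom_open.
  by apply: filterS => q iq; rewrite /= fF.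
have H : f q @[q --> p] --> F (coord i p).
  by apply: cvg_trans cFc; exact: (near_eq_cvg (F := nbhs p) near_fF).
by rewrite -fF // in H.
Qed.

Lemma local_exprK i f p : dom i p -> f p = local_expr i f (coord i p).
Proof. by move=> ip; rewrite /local_expr coordK. Qed.

Lemma Cr_fun_continuous r f : Cr_fun r f -> continuous f.
Proof.
move=> Cf p; have ip := dom_chart_at A p.
apply: (continuous_at_coord (i := chart_at A p) (F := local_expr (chart_at A p) f)) =>
    //.
  by move=> q; exact: local_exprK.
exact/(Cr_on_continuous (Cf _))/cdom_coord.
Qed.

Lemma smooth_continuous f : smooth_fun A f -> continuous f.
Proof. by move=> /(smooth_Cr_fun 0)/Cr_fun_continuous. Qed.

Definition transition i j (x : 'rV[R]_n) := coord j (param i x).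

Lemma transition_Cr i j k r :
  Cr_on r (coord i @` (dom i `&` dom j)) (fun x => transition i j x 0 k).
Proof. exact: transition_smooth. Qed.

Lemma local_expr_transition i j f x : (coord i @` (dom i `&` dom j)) x ->
  local_expr i f x = (local_expr j f \o transition i j) x.
Proof. by move=> [p [ip jp] <-]; rewrite /local_expr /transition /= !coordK. Qed.

Lemma cdom_transition i j x : (coord i @` (dom i `&` dom j)) x ->
    cdom j (transition i j x).
Proof. by move=> [p [ip jp] <-]; rewrite /transition coordK//; exact: cdom_coord. Qed.

(** Allows different formulas on different open sets, as for the extension by zero of a compactly
    supported function. *)
Lemma Cr_on_local r (U : set 'rV[R]_n) (F : 'rV[R]_n -> R) :
  (forall x, U x -> exists U', [/\ open U', U' x & Cr_on r U' F]) -> Cr_on r U F.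
Proof.
elim: r F => [|r IH] F H; first by move=> x /H[U' [_ U'x CF]]; exact: CF.
split=> [x /H[U' [_ U'x [dF _]]]|k]; first exact: dF.
by apply: IH => x /H[U' [oU U'x [_ CF]]]; exists U'; split=> //; exact: CF.
Qed.

Lemma partial_local_expr i j f x (b : 'I_n) : (coord i @` (dom i `&` dom j)) x ->
  differentiable (local_expr j f) (transition i j x) ->
  partial b (local_expr i f) x =
  \sum_c partial b (fun z => transition i j z 0 c) x *
         partial c (local_expr j f) (transition i j x).
Proof.
move=> ijx df; have oij := @open_coord_image i _ (dom_open j).
rewrite -partial_comp//.
  by apply: partial_near_eq; exact: open_near_eq oij ijx (@local_expr_transition i j f).
by move=> c; have [d _] := transition_Cr i j c 1; exact: d.
Qed.

Lemma Cr_fun_cst r (c : R) : Cr_fun r (fun=> c).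
Proof. by move=> i; exact: Cr_on_cst. Qed.

Lemma Cr_funD r f h : Cr_fun r f -> Cr_fun r h -> Cr_fun r (fun p => f p + h p).
Proof. by move=> Cf Ch i; exact: (Cr_onD (@open_cdom i) (Cf i) (Ch i)). Qed.

Lemma Cr_funN r f : Cr_fun r f -> Cr_fun r (fun p => - f p).
Proof. by move=> Cf i; exact: (Cr_onN (@open_cdom i) (Cf i)). Qed.

Lemma Cr_funM r f h : Cr_fun r f -> Cr_fun r h -> Cr_fun r (fun p => f p * h p).
Proof. by move=> Cf Ch i; exact: (Cr_onM (@open_cdom i) (Cf i) (Ch i)). Qed.

Lemma Cr_funX r f k : Cr_fun r f -> Cr_fun r (fun p => f p ^+ k).
Proof.
move=> Cf; elim: k => [|k IH]; first exact: Cr_fun_cst.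
have -> : (fun p => f p ^+ k.+1) = (fun p => f p * f p ^+ k).
  by apply/funext => p; rewrite exprS.
exact: Cr_funM.
Qed.

Lemma Cr_fun_sum r (J : Type) (s : seq J) (F : J -> M -> R) :
  (forall k, Cr_fun r (F k)) -> Cr_fun r (fun p => \sum_(k <- s) F k p).
Proof.
move=> CF i.
exact: (Cr_on_sum (P := xpredT) (F := fun k => local_expr i (F k)) s
  (@open_cdom i) (fun k _ => CF k i)).
Qed.

Lemma Cr_funV r f : Cr_fun r f -> (forall p, f p != 0) -> Cr_fun r (fun p => (f p)^-1).
Proof.
move=> Cf f0 i; rewrite /local_expr; apply: Cr_onV; [exact: open_cdom| |exact: Cf].
by move=> x _; exact: f0.
Qed.

End charts.

(** * Gradients and the weighted Laplacian in a chart *)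

Section riemann.
Context (R : realType) (n : nat) (M : ptopologicalType).
Context (A : smooth_atlas R n M) (g : riemannian_metric A).
Implicit Types (i j : chart A) (f h : M -> R).

Lemma metric_posdef i x : cdom i x -> posdef (metric g i x).
Proof. by move=> ix v; exact: metric_pos. Qed.

Lemma metric_unit i x : cdom i x -> metric g i x \in unitmx.
Proof. by move=> /metric_posdef/posdef_det_neq0; rewrite unitmxE unitfE. Qed.

Lemma invmetric_sym i x : cdom i x -> (invmx (metric g i x))^T = invmx (metric g i x).
Proof. by move=> ix; rewrite trmx_inv Defs.metric_sym. Qed.

Lemma volume_density_gt0 i x : cdom i x -> 0 < volume_density g i x.
Proof. by move=> ix; rewrite sqrtr_gt0; exact/posdef_det_gt0/metric_posdef. Qed.

Lemma volume_density_Cr r i : Cr_on r (cdom i) (volume_density g i).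
Proof.
apply: (Cr_on_sqrt (@open_cdom _ _ _ _ i)).
  by move=> x ix; exact/posdef_det_gt0/metric_posdef.
by apply: (Cr_on_det (@open_cdom _ _ _ _ i)) => a b; exact: metric_smooth.
Qed.

Lemma invmetric_Cr r i a b : Cr_on r (cdom i) (fun x => invmx (metric g i x) a b).
Proof.
apply: (Cr_on_invmx (@open_cdom _ _ _ _ i)) => [x|c d]; first exact: metric_unit.
exact: metric_smooth.
Qed.

Lemma gradientE i f x a : gradient g i f x 0 a =
  \sum_b partial b (local_expr i f) x * invmx (metric g i x) b a.
Proof. by rewrite !mxE; apply: eq_bigr => b _; rewrite !mxE. Qed.

Lemma gradient_Cr r i f a : Cr_on r.+1 (cdom i) (local_expr i f) ->
  Cr_on r (cdom i) (fun x => gradient g i f x 0 a).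
Proof.
move=> [_ Cf]; have oi := @open_cdom _ _ _ _ i.
apply: (@Cr_on_eq _ _ _ _ (fun x =>
    \sum_b partial b (local_expr i f) x * invmx (metric g i x) b a)) => //.
  by move=> x _; rewrite gradientE.
by apply: Cr_on_sum => // b _; apply: Cr_onM => //; [exact: Cf|exact: invmetric_Cr].
Qed.

(** The scalar product of two gradients, written as the differential of [h] applied to the gradient
    of [f]: this is the form that integration by parts produces. *)
Definition dot i f h (x : 'rV[R]_n) : R :=
  \sum_a gradient g i f x 0 a * partial a (local_expr i h) x.

Definition drow i f (x : 'rV[R]_n) : 'rV[R]_n := \row_b partial b (local_expr i f) x.

Lemma dot_drow i f h x : dot i f h x =
  (drow i f x *m invmx (metric g i x) *m (drow i h x)^T) 0 0.
Proof. by rewrite mxE; apply: eq_bigr => a _; congr (_ * _); rewrite !mxE. Qed.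

Lemma inner_gradient i f h x : cdom i x ->
  inner g i x (gradient g i f x) (gradient g i h x) = dot i f h x.
Proof.
move=> ix; rewrite /inner /gradient trmx_mul invmetric_sym// -/(drow i f x) -/(drow i h
    x).
by rewrite !mulmxA mulmxKV ?metric_unit// dot_drow.
Qed.

Lemma dotC i f h x : cdom i x -> dot i f h x = dot i h f x.
Proof.
move=> ix; rewrite !dot_drow -[in LHS](trmxK (_ *m _ *m _)) [in LHS]mxE.
by rewrite !trmx_mul trmxK invmetric_sym// mulmxA.
Qed.

Lemma dot_Cr r i f h : Cr_on r.+1 (cdom i) (local_expr i f) ->
  Cr_on r.+1 (cdom i) (local_expr i h) -> Cr_on r (cdom i) (dot i f h).
Proof.
move=> Cf [_ Ch]; have oi := @open_cdom _ _ _ _ i.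
by apply: Cr_on_sum => // a _; apply: Cr_onM => //; [exact: gradient_Cr|exact: Ch].
Qed.

(** Differentials change by the factor [J^T] and Gram matrices by [J] on the left and [J^T] on the
    right, so the Jacobian cancels against the inverse metric. *)
Lemma dot_transition i j f h x : (coord i @` (dom i `&` dom j)) x ->
  differentiable (local_expr j f) (transition i j x) ->
  differentiable (local_expr j h) (transition i j x) ->
  dot i f h x = dot j f h (transition i j x).
Proof.
move=> ijx df dh; set y := transition i j x.
pose J : 'M[R]_n := \matrix_(a, b) partial a (fun z => transition i j z 0 b) x.
have ix : cdom i x by case: ijx => p [ip _] <-; exact: cdom_coord.
have jy : cdom j y by exact: cdom_transition.
have Gi : metric g i x = J *m metric g j y *m J^T by exact: metric_change.
(* Invertibility of the Jacobian is read off from [metric_change]: it is a factor of the invertible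
   matrix [metric g i x]. *)
have Ju : J^T \in unitmx.
  have := metric_unit ix; rewrite Gi unitmx_mul => /andP[_]; exact.
have drowE k : differentiable (local_expr j k) y -> drow i k x = drow j k y *m J^T.
  move=> dk; apply/rowP => b; rewrite mxE (partial_local_expr _ ijx dk) !mxE.
  by apply: eq_bigr => c _; rewrite !mxE mulrC.
have JGJ : J^T *m invmx (metric g i x) *m J = invmx (metric g j y).
  have E : J^T *m invmx (metric g i x) *m J *m metric g j y = 1%:M.
    rewrite -[LHS](mulmxK Ju) -!mulmxA [J *m (_ *m (_ *m _))]mulmxA.
    rewrite [J *m _ *m _]mulmxA -Gi.
    by rewrite (mulmxA (invmx _) (metric g i x)) mulVmx ?metric_unit// mul1mx mulmxV.
  by rewrite -[LHS](mulmxK (metric_unit jy)) E mul1mx.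
rewrite !dot_drow (drowE _ df) (drowE _ dh) -JGJ trmx_mul trmxK.
by rewrite !mulmxA.
Qed.

Lemma grad_dotE f h p : grad_dot g f h p = dot (chart_at A p) f h (coord
    (chart_at A p) p).
Proof. exact/inner_gradient/cdom_coord/dom_chart_at. Qed.

(** Frees [grad_dot] from the chart chosen at [p]. Only first derivatives enter, so this is pure
    tensor algebra, unlike the corresponding fact for [L]. *)
Lemma grad_dot_chart i f h p : Cr_fun A 1 f -> Cr_fun A 1 h -> dom i p ->
  grad_dot g f h p = dot i f h (coord i p).
Proof.
move=> Cf Ch ip; rewrite grad_dotE; set j := chart_at A p.
have jp : dom j p := dom_chart_at A p.
have T : transition j i (coord j p) = coord i p by rewrite /transition coordK.
rewrite -T; apply: dot_transition; first by exists p.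
  by rewrite T; have [d _] := Cf i; apply: d; exact: cdom_coord.
by rewrite T; have [d _] := Ch i; apply: d; exact: cdom_coord.
Qed.

Lemma gradientM i f h x a : cdom i x -> differentiable (local_expr i f) x ->
  differentiable (local_expr i h) x ->
  gradient g i (fun p => f p * h p) x 0 a =
  local_expr i f x * gradient g i h x 0 a + local_expr i h x * gradient g i f x 0 a.
Proof.
move=> ix df dh; rewrite !gradientE !mulr_sumr -big_split /=; apply: eq_bigr => b _.
have := partialM b df dh; rewrite {1}/local_expr => ->.
by rewrite mulrDl !mulrA [local_expr i h x * _]mulrC.
Qed.

Variable V : M -> R.
Hypothesis smV : smooth_fun A V.

(* Density of [mu] with respect to Lebesgue measure in the chart [i]. *)
Definition wdens i x := expR (local_expr i V x) * volume_density g i x.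

Lemma wdens_gt0 i x : cdom i x -> 0 < wdens i x.
Proof. by move=> ix; rewrite mulr_gt0 ?expR_gt0 ?volume_density_gt0. Qed.

Lemma wdens_Cr r i : Cr_on r (cdom i) (wdens i).
Proof.
have oi := @open_cdom _ _ _ _ i.
by apply: Cr_onM => //; [apply: Cr_on_expR => //; exact: smV|exact: volume_density_Cr].
Qed.

(** [weighted_laplacian] computed in an arbitrary chart instead of the one chosen at the point; that
    the two agree is settled only by [weighted_laplacian_chart]. *)
Definition chart_laplacian i f x :=
  divergence g i (gradient g i f) x + inner g i x (gradient g i V x) (gradient g i f x).

Lemma weighted_laplacianE f p : weighted_laplacian g V f p =
  chart_laplacian (chart_at A p) f (coord (chart_at A p) p).
Proof. by []. Qed.

(** Differentiating the factor [e^V] of [wdens] produces exactly the drift term along the gradient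
    of [V]. *)
Lemma chart_laplacianE i f x : cdom i x -> Cr_on 2 (cdom i) (local_expr i f) ->
  chart_laplacian i f x =
  (wdens i x)^-1 * \sum_a partial a (fun y => wdens i y * gradient g i f y 0 a) x.
Proof.
move=> ix Cf; rewrite /chart_laplacian inner_gradient// dotC//; last first.
rewrite /divergence.
have dexp : differentiable (fun y => expR (local_expr i V y)) x.
  by have [d _] := Cr_on_expR (@open_cdom _ _ _ _ i) (smV i 1); exact: d.
have drg a : differentiable (fun y => volume_density g i y * gradient g i f y 0 a) x.
  apply: differentiableM.
    by have [d _] := volume_density_Cr 1 i; exact: d.
  by have [d _] := @gradient_Cr 1 i f a Cf; exact: d.
have pa a : partial a (fun y => wdens i y * gradient g i f y 0 a) x =
    expR (local_expr i V x) * partial a (fun y =>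
        volume_density g i y * gradient g i f y 0 a) x
    + expR (local_expr i V x) * partial a (local_expr i V) x * (volume_density g i x
        * gradient g i f x 0 a).
  rewrite (_ : (fun y => _) = fun y =>
      expR (local_expr i V y) * (volume_density g i y * gradient g i f y 0 a)).
    rewrite partialM//; congr (_ + _ * _).
    have dV : differentiable (local_expr i V) x by have [d _] := smV i 1; exact: d.
    by have [_ ->] := partial_comp1 a dV (is_derive_expR _).
  by apply/funext => y; rewrite /wdens mulrA.
under [in RHS]eq_bigr do rewrite pa.
have v0 := volume_density_gt0 ix; have e0 := expR_gt0 (local_expr i V x).
rewrite big_split /= -mulr_sumr mulrDr; congr (_ + _).
  by rewrite mulrA; congr (_ * _); rewrite /wdens; field; rewrite !gt_eqF.
rewrite /dot mulr_sumr; apply: eq_bigr => a _.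
by rewrite /wdens; field; rewrite !gt_eqF.
Qed.

Lemma chart_laplacian_Cr r i f : Cr_on r.+2 (cdom i) (local_expr i f) ->
  Cr_on r (cdom i) (chart_laplacian i f).
Proof.
move=> Cf; have oi := @open_cdom _ _ _ _ i.
apply: (@Cr_on_eq _ _ _ _ (fun x => (wdens i x)^-1 * \sum_a partial a (fun y =>
    wdens i y * gradient g i f y 0 a) x)) => //.
  move=> x ix; rewrite chart_laplacianE//.
  by elim: r Cf => [//|r IH] /Cr_onS.
apply: Cr_onM => //.
  by apply: Cr_onV => // [x ix|]; [rewrite gt_eqF// wdens_gt0|exact: wdens_Cr].
apply: Cr_on_sum => // a _.
have [_ C] : Cr_on r.+1 (cdom i) (fun y => wdens i y * gradient g i f y 0 a).
  by apply: Cr_onM => //; [exact: wdens_Cr|exact: gradient_Cr].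
exact: C.
Qed.

(** The product rule is applied twice; the two cross terms coincide by the symmetry of [dot], whence
    the factor 2. *)
Lemma chart_laplacianM i f h x : cdom i x -> Cr_on 2 (cdom i) (local_expr i f) ->
  Cr_on 2 (cdom i) (local_expr i h) ->
  chart_laplacian i (fun p => f p * h p) x =
  local_expr i f x * chart_laplacian i h x + local_expr i h x * chart_laplacian i f x
  + 2 * dot i f h x.
Proof.
move=> ix Cf Ch; have oi := @open_cdom _ _ _ _ i.
have Cfh : Cr_on 2 (cdom i) (local_expr i (fun p =>
    f p * h p)) by exact: (Cr_onM oi Cf Ch).
rewrite (chart_laplacianE ix Cf) (chart_laplacianE ix Ch) (chart_laplacianE ix Cfh).
have [df _] := Cf; have [dh _] := Ch.
have dwg k a : Cr_on 2 (cdom i) (local_expr i k) -> differentiable (fun y =>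
    wdens i y * gradient g i k y 0 a) x.
  move=> Ck; have [d _] : Cr_on 1 (cdom i) (fun y => wdens i y * gradient g i k y 0 a).
    by apply: Cr_onM => //; [exact: wdens_Cr|exact: gradient_Cr].
  exact: d.
have pa a : partial a (fun y => wdens i y * gradient g i (fun p => f p * h p) y 0 a) x =
    local_expr i f x * partial a (fun y => wdens i y * gradient g i h y 0 a) x
    + local_expr i h x * partial a (fun y => wdens i y * gradient g i f y 0 a) x
    + wdens i x * (gradient g i h x 0 a * partial a (local_expr i f) x
                   + gradient g i f x 0 a * partial a (local_expr i h) x).
  have -> : partial a (fun y => wdens i y * gradient g i (fun p => f p * h p) y 0 a) x =
      partial a (fun y => local_expr i f y * (wdens i y * gradient g i h y 0 a)
                   + local_expr i h y * (wdens i y * gradient g i f y 0 a)) x.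
    apply: partial_near_eq; apply: (open_near_eq oi ix) => y iy.
    by rewrite gradientM//; [ring|exact: df|exact: dh].
  have d1 : differentiable (fun y =>
      local_expr i f y * (wdens i y * gradient g i h y 0 a)) x.
    by apply: differentiableM; [exact: df|exact: dwg].
  have d2 : differentiable (fun y =>
      local_expr i h y * (wdens i y * gradient g i f y 0 a)) x.
    by apply: differentiableM; [exact: dh|exact: dwg].
  rewrite (partialD _ d1 d2) (partialM a (df x ix) (dwg h a Ch)) (partialM a (dh x ix)
      (dwg f a Cf)).
  set F := local_expr i f x; set H := local_expr i h x; set w := wdens i x.
  set PF := partial a (local_expr i f) x; set PH := partial a (local_expr i h) x.
  set GF := gradient g i f x 0 a; set GH := gradient g i h x 0 a.
  move: (partial a _ x) (partial a _ x) => D1 D2.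
  by ring.
have w0 : wdens i x != 0 by rewrite gt_eqF// wdens_gt0.
set Sfh := (X in _ * X = _); set Sh := (X in _ = _ * (_ * X) + _ + _);
    set Sf := (X in _ = _ + _ * (_ * X) + _).
have -> : Sfh = local_expr i f x * Sh + local_expr i h x * Sf
    + wdens i x * (dot i h f x + dot i f h x).
  rewrite /dot -big_split /= !mulr_sumr -!big_split /=.
  by apply: eq_bigr => a _; exact: pa.
rewrite (dotC h f ix).
move: Sh Sf (dot _ _ _ _) => S1 S2 D.
by field.
Qed.

(** The three values of [L] in [Gamma] are taken at the same point, hence in the same chart, so the
    identity can precede chart independence. *)
Lemma Gamma_grad_dot f h p : smooth_fun A f -> smooth_fun A h ->
  Gamma (weighted_laplacian g V) f h p = grad_dot g f h p.
Proof.
move=> sf sh; rewrite /Gamma !weighted_laplacianE grad_dotE; set i := chart_at A p.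
have ip : dom i p := dom_chart_at A p; have cp := cdom_coord ip.
rewrite chart_laplacianM//; [|exact: sf|exact: sh].
rewrite (local_exprK f ip) (local_exprK h ip); field => //.
Qed.

End riemann.

(** Both integrals are differences of those of the positive and negative parts, and multiplication
    by [w >= 0] commutes with taking these parts. *)
Lemma integral_density d1 d2 (X : measurableType d1) (Y : measurableType d2)
    (R : realType) (lam : {measure set X -> \bar R}) (nu : {measure set Y -> \bar R})
    (phi : X -> Y) (D : set X) (E : set Y) (w : X -> R) :
  measurable D -> measurable E -> measurable_fun D phi -> (forall x, D x ->
      E (phi x)) ->
  measurable_fun D w -> (forall x, D x -> 0 <= w x) ->
  (forall B, measurable B -> B `<=` E ->
     nu B = (\int[lam]_(x in D `&` phi @^-1` B) (w x)%:E)%E) ->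
  forall h : Y -> R, measurable_fun E h ->
  (\int[nu]_(y in E) (h y)%:E = \int[lam]_(x in D) (h (phi x) * w x)%:E)%E.
Proof.
move=> mD mE mphi DE mw w0 nuE h mh.
have dens := ge0_integral_density mD mE mphi DE mw w0 nuE.
rewrite integralE [RHS]integralE; congr (_ - _)%E.
  transitivity (\int[nu]_(y in E) (Num.max (h y) 0)%:E)%E.
    by apply: eq_integral => y _; rewrite funeposE EFin_max.
  rewrite dens; first last.
  - by move=> y _; rewrite le_max lexx orbT.
  - by apply: measurable_maxr => //; exact: measurable_cst.
  apply: eq_integral => x /[!inE] Dx; rewrite funeposE -EFin_max; congr EFin.
  by rewrite maxr_pMl ?w0// mul0r.
transitivity (\int[nu]_(y in E) (Num.max (- h y) 0)%:E)%E.
  by apply: eq_integral => y _; rewrite funenegE EFin_max.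
rewrite dens; first last.
- by move=> y _; rewrite le_max lexx orbT.
- by apply: measurable_maxr; [exact: measurableT_comp|exact: measurable_cst].
apply: eq_integral => x /[!inE] Dx; rewrite funenegE -EFinN -EFin_max; congr EFin.
by rewrite maxr_pMl ?w0// mul0r mulNr.
Qed.

(** * The weighted measure in charts *)

Section weighted_measure.
Context (R : realType) (n : nat) (M : ptopologicalType).
Context (A : smooth_atlas R n M) (g : riemannian_metric A).
Context (vol : {measure set (borel M) ->
    \bar R}) (mu : probability (borel M) R) (V : M -> R).
Hypotheses (volP : is_riemannian_volume g vol) (smV : smooth_fun A V).
Hypothesis muE : forall B : set (borel M), measurable B ->
  mu B = (\int[vol]_(p in B) (expR (V p))%:E)%E.
Implicit Types (i j : chart A) (f h : M -> R).

Lemma borel_open (O : set M) : open O -> measurable (O : set (borel M)).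
Proof. exact: sub_sigma_algebra. Qed.

Lemma measurable_dom i : measurable (dom i : set (borel M)).
Proof. by apply: borel_open; exact: dom_open. Qed.

Definition chart_pt i (t : n.-tuple R) : borel M := param i (row_of_tuple t).

Definition tdom i : set (n.-tuple R) := @row_of_tuple R n @^-1` cdom i.

Lemma measurable_tdom i : measurable (tdom i).
Proof. by apply: measurable_row_of_tuple_open; exact: open_cdom. Qed.

Lemma measurable_chart_pt i : measurable_fun (tdom i) (chart_pt i).
Proof.
have E : @measurable _ (borel M) = <<s @open M >> by [].
apply: (measurability _ E) => // _ [Q oQ <-].
have -> : tdom i `&` chart_pt i @^-1` Q = @row_of_tuple R n @^-1` (coord i @`
    (dom i `&` Q)).
  by rewrite coord_imageE.
by apply: measurable_row_of_tuple_open; exact: open_coord_image.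
Qed.

Lemma measurable_continuous_dom i h : (forall p, dom i p -> {for p, continuous h}) ->
  measurable_fun (dom i : set (borel M)) (h : borel M -> R).
Proof.
exact: (@measurable_fun_continuous_on R _ (borel M) M id (dom i) h borel_open
    (@dom_open _ _ _ _ i)).
Qed.

Lemma measurable_continuous h : continuous h -> measurable_fun setT (h : borel M -> R).
Proof.
move=> ch; apply: (@measurable_fun_continuous_on R _
    (borel M) M id setT h borel_open openT) => p _.
exact: ch.
Qed.

Lemma measurable_tdom_continuous i (F : 'rV[R]_n -> R) : Cr_on 0 (cdom i) F ->
  measurable_fun (tdom i) (fun t => F (row_of_tuple t)).
Proof.
move=> CF; apply: (@measurable_fun_continuous_on R _ _ _ (@row_of_tuple R n)
    (cdom i) F) => //.
  exact: measurable_row_of_tuple_open.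
exact: open_cdom.
Qed.

Lemma vol_chart i (B : set (borel M)) : measurable B -> B `<=` dom i ->
  vol B = (\int[lebesgue_measure_tuple R n]_(t in tdom i `&` chart_pt i @^-1` B)
             (volume_density g i (row_of_tuple t))%:E)%E.
Proof.
move=> mB Bi; rewrite (volP mB Bi).
have -> : [set t | (coord i @` B) (row_of_tuple t)] = tdom i `&` chart_pt i @^-1` B =>
    //.
by rewrite -{1}(setIidr Bi) coord_imageE.
Qed.

Lemma measurable_chart_preimage i (B : set (borel M)) : measurable B ->
  measurable (tdom i `&` chart_pt i @^-1` B).
Proof. by move=> mB; apply: measurable_chart_pt => //; exact: measurable_tdom. Qed.

(** The density [e^V] relative to [vol] is pulled back to the chart, where it multiplies
    [volume_density]. The set [B] itself is taken as the domain in the density lemma. *)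
Lemma mu_chart i (B : set (borel M)) : measurable B -> B `<=` dom i ->
  mu B = (\int[lebesgue_measure_tuple R n]_(t in tdom i `&` chart_pt i @^-1` B)
            (wdens g V i (row_of_tuple t))%:E)%E.
Proof.
move=> mB Bi; rewrite muE//.
have sD : tdom i `&` chart_pt i @^-1` B `<=` tdom i by move=> t [].
rewrite (@ge0_integral_density _ _ _ _ R (lebesgue_measure_tuple R n) vol (chart_pt i)
  (tdom i `&` chart_pt i @^-1` B) B (fun t => volume_density g i (row_of_tuple t))) //.
- exact: measurable_chart_preimage.
- apply: (measurable_funS (measurable_tdom i)) => //; exact: measurable_chart_pt.
- by move=> t [].
- apply: (measurable_funS (measurable_tdom i)) => //.
  by apply: measurable_tdom_continuous; exact: volume_density_Cr.
- by move=> t [it _]; apply/ltW/volume_density_gt0.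
- move=> C mC CB; rewrite (@vol_chart i _ mC); last exact: subset_trans Bi.
  congr (integral _ _ _); rewrite -setIA; congr (_ `&` _).
  by rewrite -preimage_setI (setIidr CB).
- apply: measurable_funTS; apply: (measurable_continuous (h := fun p => expR (V p))).
  move=> p; apply: continuous_comp; first exact: smooth_continuous.
  exact: continuous_expR.
Qed.

Lemma integral_chart i h : (forall p, dom i p -> {for p, continuous h}) ->
  (\int[mu]_(p in dom i) (h p)%:E =
   \int[lebesgue_measure_tuple R n]_(t in tdom i)
     (h (param i (row_of_tuple t)) * wdens g V i (row_of_tuple t))%:E)%E.
Proof.
move=> ch.
rewrite (@integral_density _ _ _ _ R (lebesgue_measure_tuple R n) mu (chart_pt i)
  (tdom i) (dom i) (fun t => wdens g V i (row_of_tuple t))) //.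
- exact: measurable_tdom.
- exact: measurable_dom.
- exact: measurable_chart_pt.
- by move=> t; exact: dom_param.
- by apply: measurable_tdom_continuous; exact: wdens_Cr.
- by move=> t it; apply/ltW/wdens_gt0.
- by move=> B mB Bi; exact: mu_chart.
- exact: measurable_continuous_dom.
Qed.

(** In a chart, the density exceeds half its value at a point on a small cube inside the open set,
    and the cube has positive Lebesgue measure. *)
Lemma mu_open_gt0 (O : set M) : open O -> O !=set0 -> (0 < mu O)%E.
Proof.
move=> oO [p Op]; pose i := chart_at A p; have ip : dom i p := dom_chart_at A p.
pose B := dom i `&` O; have oB : open B by apply: openI => //; exact: dom_open.
have BO : B `<=` O by move=> q [].
have Bi : B `<=` dom i by move=> q [].
apply: (@lt_le_trans _ _ (mu B)); last first.
  by apply: le_measure => //; rewrite inE; exact: borel_open.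
rewrite (mu_chart (borel_open oB) Bi).
pose W := wdens g V i; pose x := coord i p.
have ix : cdom i x by exact: cdom_coord.
have W0 : 0 < W x by exact: wdens_gt0.
have cW : {for x, continuous W} by exact: Cr_on_continuous (wdens_Cr g smV 0 i) x ix.
have nW : nbhs x [set y | W x / 2 < W y].
  by apply: (cvgr_gt _ cW); rewrite ltr_pdivrMr// ltr_pMr// ltr1n.
have nB : nbhs x (coord i @` B).
  by apply: open_nbhs_nbhs; split; [exact: open_coord_image|exists p].
have /nbhs_ballP[r /= r0 Hr] : nbhs x ([set y | W x / 2 < W y] `&` (coord i @` B))
    by exact: filterI.
pose c : n.-tuple R := [tuple x 0 k | k < n].
have boxP t : tuple_box c r t ->
    W x / 2 < W (row_of_tuple t) /\ (coord i @` B) (row_of_tuple t).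
  move=> ct; apply: Hr; split=> // a b; rewrite !mxE ord1.
  have := ct b; rewrite tnth_mktuple /= in_itv /= => /andP[c1 c2].
  by rewrite -ball_normE /= ltr_norml; apply/andP; split; lra.
have DE : tdom i `&` chart_pt i @^-1` B = @row_of_tuple R n @^-1` (coord i @` B).
  by rewrite -[in RHS](setIidr Bi) coord_imageE.
have mbox := measurable_tuple_box c r.
apply: (@lt_le_trans _ _ (\int[lebesgue_measure_tuple R n]_(t in tuple_box c r)
    (W x / 2)%:E)%E).
  rewrite integral_cst//= lebesgue_measure_tuple_box// -EFinM lte_fin.
  by rewrite mulr_gt0 ?divr_gt0// exprn_gt0// mulr_gt0.
have mW : measurable_fun (tdom i `&` chart_pt i @^-1` B) (fun t =>
    (W (row_of_tuple t))%:E).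
  apply/measurable_EFinP; apply: (measurable_funS (measurable_tdom i));
      first by move=> t [].
  by apply: measurable_tdom_continuous; exact: wdens_Cr.
have sub : tuple_box c r `<=` tdom i `&` chart_pt i @^-1` B.
  by rewrite DE => t /boxP[].
apply: (@le_trans _ _ (\int[lebesgue_measure_tuple R n]_(t in tuple_box c r) (W
    (row_of_tuple t))%:E)%E).
  apply: ge0_le_integral => //.
  - by move=> t _; rewrite lee_fin ltW// divr_gt0.
  - by apply: measurable_funS mW => //; apply: measurable_chart_preimage;
      exact: borel_open.
  - by move=> t /boxP[/ltW]; rewrite lee_fin.
apply: ge0_subset_integral => //.
- by apply: measurable_chart_preimage; exact: borel_open.
- by move=> t [it _]; rewrite lee_fin ltW// wdens_gt0.
Qed.

Hypothesis compactM : compact [set: M].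

Lemma integrable_continuous h : continuous h ->
    mu.-integrable setT (EFin \o (h : borel M -> R)).
Proof.
move=> ch; apply: measurable_bounded_integrable => //.
- by rewrite -ge0_fin_numE// fin_num_measure.
- exact: measurable_continuous.
- have : bounded_set (h @` [set: M]).
    by apply: compact_bounded; apply: continuous_compact => //;
        exact: continuous_subspaceT.
  case=> K [rK HK]; exists K; split => // y Ky p _ /=.
  by apply: HK => //; exists p.
Qed.

(** A positive value would persist, up to the factor 2, on an open set, which has positive mass.
    This is how equalities of integrals become pointwise. *)
Lemma ge0_Rintegral_eq0 h : continuous h -> (forall p, 0 <= h p) ->
  \int[mu]_p h p = 0 -> forall p, h p = 0.
Proof.
move=> ch h0 ih p; apply/eqP; rewrite eq_le h0 andbT leNgt; apply/negP => hp.
pose O := [set q | h p / 2 < h q].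
have oO : open O.
  rewrite openE => q Oq; exact: (cvgr_gt _ (ch q)).
have Op : O p by rewrite /O /= ltr_pdivrMr// ltr_pMr// ltr1n.
have mO : (0 < mu O)%E by apply: mu_open_gt0 => //; exists p.
have fO : mu O \is a fin_num by apply: fin_num_measure; exact: borel_open.
suff : 0 < \int[mu]_p h p by rewrite ih ltxx.
apply: (@lt_le_trans _ _ (\int[mu]_(q in O) (h p / 2))).
  rewrite Rintegral_cst; last exact: borel_open.
  by rewrite mulr_gt0 ?divr_gt0// fine_gt0// mO ltey_eq fO.
rewrite Rintegral_mkcond; apply: le_Rintegral => //.
- have := finite_measure_integrable_cst mu (h p / 2) (borel_open oO).
  by move=> /(integrable_mkcond _ (borel_open oO)); rewrite restrict_EFin.
- exact: integrable_continuous.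
- by move=> q _; rewrite patchE; case: ifPn => [/set_mem/ltW//|_]; exact: h0.
Qed.

End weighted_measure.

(** * Integration by parts *)

Section local_integration_by_parts.
Context (R : realType) (n : nat) (M : ptopologicalType).
Context (A : smooth_atlas R n M) (g : riemannian_metric A).
Context (vol : {measure set (borel M) ->
    \bar R}) (mu : probability (borel M) R) (V : M -> R).
Hypotheses (volP : is_riemannian_volume g vol) (smV : smooth_fun A V).
Hypothesis muE : forall B : set (borel M), measurable B ->
  mu B = (\int[vol]_(p in B) (expR (V p))%:E)%E.
Hypotheses (hausM : hausdorff_space M) (compactM : compact [set: M]).
Implicit Types (i j : chart A) (f h u : M -> R) (K : set M).

Lemma coord_image_compact i K : compact K -> K `<=` dom i -> compact (coord i @` K).
Proof.
move=> cK Ki; apply: continuous_compact => //.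
by apply: continuous_in_subspaceT => p /set_mem/Ki; exact: Defs.coord_continuous.
Qed.

Lemma compact_row_bounded (C : set 'rV[R]_n) : compact C ->
  exists2 B : R, 0 < B & forall (x : 'rV[R]_n) k, C x -> `|x 0 k| <= B.
Proof.
move=> /compact_bounded[N [_ HN]]; exists (`|N| + 1); first by rewrite ltr_wpDl.
move=> x k Cx; have : `|x| <= `|N| + 1.
  by apply: HN => //; rewrite (le_lt_trans (ler_norm N))// ltrDl.
apply: le_trans; rewrite [leRHS]/Num.Def.normr /= mx_normrE.
exact: (le_bigmax _ (fun ij => `|x ij.1 ij.2|) (0, k)).
Qed.

Lemma local_expr_support i K u x : (forall p, ~ K p -> u p = 0) -> cdom i x ->
  ~ (coord i @` K) x -> local_expr i u x = 0.
Proof.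
move=> u0 ix nKx; apply: u0 => Kx; apply: nKx; exists (param i x) => //.
exact: paramK.
Qed.

Lemma continuous_supported i K h : compact K -> K `<=` dom i ->
  (forall p, ~ K p -> h p = 0) -> (forall p, dom i p -> {for p, continuous h}) ->
  continuous h.
Proof.
move=> cK Ki h0 ch p; have [/Ki/ch//|nKp] := pselect (K p).
have np : {near p, (fun=> 0) =1 h}.
  have : nbhs p (~` K).
    by apply: open_nbhs_nbhs; split => //; apply: closed_openC; exact: compact_closed.
  by apply: filterS => q; move/h0 => ->.
have H : h q @[q --> p] --> (0 : R).
  by apply: (cvg_trans (near_eq_cvg (F := nbhs p) np)); exact: cvg_cst.
by rewrite -(h0 p nKp) in H.
Qed.

Section fixed_chart.
Variables (i : chart A) (K : set M) (u f : M -> R).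
Hypotheses (cK : compact K) (Ki : K `<=` dom i) (u0 : forall p, ~ K p -> u p = 0).
Hypotheses (Cu : Cr_on 1 (cdom i) (local_expr i u)) (Cf : Cr_on 2 (cdom i)
    (local_expr i f)).

Let oi := @open_cdom _ _ _ _ i.
(** Components of the field whose Euclidean divergence is [u L f + Gamma(f, u)] times the density;
    see [sum_partial_G]. *)
Let G a y := local_expr i u y * (wdens g V i y * gradient g i f y 0 a).
(* Extension of [G a] by zero, of class C^1 on all of R^n since [u] vanishes
   outside the compact [K]. *)
Let w a y := if y \in cdom i then G a y else 0.

Let CwG a : Cr_on 1 (cdom i) (fun y => wdens g V i y * gradient g i f y 0 a).
Proof. by apply: (Cr_onM oi); [exact: wdens_Cr|exact: gradient_Cr]. Qed.

Let CG a : Cr_on 1 (cdom i) (G a).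
Proof. exact: (Cr_onM oi Cu (CwG a)). Qed.

Let oK : open (~` (coord i @` K)).
Proof.
apply: closed_openC; apply: compact_closed; first exact: norm_hausdorff.
exact: coord_image_compact.
Qed.

Let wG a y : cdom i y -> w a y = G a y.
Proof. by move=> iy; rewrite /w mem_set. Qed.

Let w0 a y : ~ (coord i @` K) y -> w a y = 0.
Proof.
move=> nKy; rewrite /w; case: ifPn => // /set_mem iy.
by rewrite /G (local_expr_support u0 iy nKy) mul0r.
Qed.

(** The open sets [cdom i] and the complement of the image of [K] cover R^n; [w a] is [G a] on the
    first and zero on the second. *)
Let Cw a : Cr_on 1 setT (w a).
Proof.
apply: Cr_on_local => y _; have [iy|niy] := pselect (cdom i y).
  exists (cdom i); split; [exact: oi|exact: iy|].
  by apply: (Cr_on_eq oi _ (CG a)) => x ix; rewrite wG.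
exists (~` (coord i @` K)); split=> //.
  by apply: contra_not niy => -[p Kp <-]; exact/cdom_coord/Ki.
by apply: (Cr_on_eq oK _ (Cr_on_cst _ _ 0)) => x nx; rewrite w0.
Qed.

Let partial_w_in a y : cdom i y -> partial a (w a) y = partial a (G a) y.
Proof. by move=> iy; apply: partial_near_eq; apply: open_near_eq oi iy _ => x;
    exact: wG. Qed.

Let partial_w_out a y : ~ cdom i y -> partial a (w a) y = 0.
Proof.
move=> niy; have nKy : ~ (coord i @` K) y.
  by apply: contra_not niy => -[p Kp <-]; exact/cdom_coord/Ki.
rewrite (@partial_near_eq _ _ a _ (fun=> 0)); first by rewrite /partial derive_cst.
by apply: open_near_eq oK nKy _ => x; exact: w0.
Qed.

Let sum_partial_G y : cdom i y ->
  (local_expr i u y * chart_laplacian g V i f y + dot g i f u y) * wdens g V i y =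
  \sum_a partial a (G a) y.
Proof.
move=> iy; have W0 : wdens g V i y != 0 by rewrite gt_eqF// wdens_gt0.
rewrite (chart_laplacianE g smV iy Cf).
have pG a : partial a (G a) y =
    local_expr i u y * partial a (fun y => wdens g V i y * gradient g i f y 0 a) y +
    wdens g V i y * (gradient g i f y 0 a * partial a (local_expr i u) y).
  have [du _] := Cu; have [dw _] := CwG a.
  by rewrite [LHS](partialM a (du y iy) (dw y iy)); congr (_ + _); rewrite mulrC mulrA.
rewrite (eq_bigr _ (fun a _ => pG a)) big_split /= -!mulr_sumr /dot.
move: (\sum_a _) (\sum_a _) => S1 S2.
by field.
Qed.

Lemma local_integration_by_parts_dom :
  (\int[mu]_(p in dom i) (u p * chart_laplacian g V i f (coord i p) +
                          dot g i f u (coord i p))%:E = 0)%E.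
Proof.
rewrite (integral_chart volP smV muE); last first.
  move=> p ip; apply: (continuous_at_coord (i := i)
      (F := fun x => local_expr i u x * chart_laplacian g V i f x + dot g i f u x)) =>
          //.
    by move=> q iq; rewrite (local_exprK u iq).
  have C : Cr_on 0 (cdom i) (fun x =>
      local_expr i u x * chart_laplacian g V i f x + dot g i f u x).
    apply: (Cr_onD oi); last by apply: dot_Cr; [exact: Cr_onS Cf|exact: Cu].
    by apply: (Cr_onM oi); [exact: Cr_onS Cu|exact: (chart_laplacian_Cr g smV Cf)].
  exact/C/cdom_coord.
(* Extension by zero turns the integral over [cdom i] into one over R^n, where [integral_partial]
   disposes of each component. *)
transitivity (\int[lebesgue_measure_tuple R n]_t
    (\sum_a (partial a (w a) (row_of_tuple t))%:E))%E.
  rewrite integral_mkcond; apply: eq_integral => t _; rewrite patchE.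
  case: ifPn => [/set_mem it|/negP nit].
    rewrite paramK// -/(local_expr i u (row_of_tuple t)) sum_partial_G// sumEFin.
    by congr EFin; apply: eq_bigr => a _; rewrite partial_w_in.
  rewrite big1// => a _; rewrite partial_w_out// => it.
  by apply: nit; exact: mem_set.
have [B B0 HB] := compact_row_bounded (coord_image_compact cK Ki).
have wB a (x : 'rV[R]_n) k : B < `|x 0 k| -> w a x = 0.
  by move=> Bx; apply: w0 => /(HB x k); rewrite leNgt Bx.
have cpw a : continuous (partial a (w a)).
  by move=> x; have [_ C] := Cw a; exact: C.
rewrite integral_sum//; last first.
  move=> a; apply: (integrable_compact_support B0 (cpw a)).
  by apply: partial_support; exact: wB.
apply: big1 => a _; apply: (integral_partial B0 _ (cpw a) (wB a)) => x.
by apply: diff_derivable; have [d _] := Cw a; exact: d.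
Qed.

End fixed_chart.

Lemma grad_dot_support K f u p : closed K -> (forall q, ~ K q -> u q = 0) -> ~ K p ->
  grad_dot g f u p = 0.
Proof.
move=> cK u0 nKp; rewrite grad_dotE; set i := chart_at A p.
have ip : dom i p := dom_chart_at A p.
apply: big1 => a _; rewrite (@partial_near_eq _ _ a _ (fun=> 0)).
  by rewrite /partial derive_cst mulr0.
have oK := @open_coord_image _ _ _ _ i _ (closed_openC cK).
apply: (open_near_eq oK); first by exists p.
by move=> x [q [iq nKq] <-]; rewrite /local_expr coordK// u0.
Qed.

Lemma continuous_grad_dot f u : Cr_fun A 1 f -> Cr_fun A 1 u ->
  continuous (grad_dot g f u).
Proof.
move=> Cf Cu p; pose i := chart_at A p; have ip : dom i p := dom_chart_at A p.
apply: (continuous_at_coord (F := dot g i f u) ip).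
  by move=> q iq; exact: grad_dot_chart.
have C : Cr_on 0 (cdom i) (dot g i f u) by exact: dot_Cr.
exact/C/cdom_coord.
Qed.

(** [coord i] is arbitrary off [dom i]; the compact support of [u] inside [dom i] makes the product
    continuous on all of [M]. *)
Lemma continuous_chart_laplacian i K u f : compact K -> K `<=` dom i ->
  (forall p, ~ K p -> u p = 0) -> Cr_fun A 1 u -> smooth_fun A f ->
  continuous (fun p => u p * chart_laplacian g V i f (coord i p)).
Proof.
move=> cK Ki u0 Cu sf; apply: (continuous_supported cK Ki) => [p /u0 ->|p ip].
  by rewrite mul0r.
apply: (continuous_at_coord (F := fun x =>
    local_expr i u x * chart_laplacian g V i f x) ip).
  by move=> q iq; rewrite (local_exprK u iq).
have C : Cr_on 0 (cdom i) (fun x => local_expr i u x * chart_laplacian g V i f x).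
  by apply: Cr_onM; [exact: open_cdom|exact: Cr_onS (Cu i)|exact:
      (chart_laplacian_Cr g smV (sf i 2))].
exact/C/cdom_coord.
Qed.

Lemma local_integration_by_parts i K u f : compact K -> K `<=` dom i ->
  (forall p, ~ K p -> u p = 0) -> Cr_fun A 1 u -> smooth_fun A f ->
  \int[mu]_p (u p * chart_laplacian g V i f
      (coord i p)) = - \int[mu]_p grad_dot g f u p.
Proof.
move=> cK Ki u0 Cu sf; have Cf r : Cr_fun A r f := smooth_Cr_fun r sf.
have clK := compact_closed hausM cK.
have I1 := integrable_continuous mu compactM
    (continuous_chart_laplacian cK Ki u0 Cu sf).
have I2 := integrable_continuous mu compactM (continuous_grad_dot (Cf 1) Cu).
apply/eqP; rewrite -subr_eq0 opprK -RintegralD//.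
rewrite /Rintegral; have H := local_integration_by_parts_dom cK Ki u0 (Cu i) (Cf 2 i).
rewrite integral_mkcond in H; apply/eqP; rewrite -[RHS]/(fine 0%E) -H; congr fine.
apply: eq_integral => p _; rewrite patchE; case: ifPn => [/set_mem ip|/negP nip].
  by rewrite (grad_dot_chart g (Cf 1) Cu ip).
(* Off [dom i] the value of [coord i] is meaningless, but the point is off [K] and both terms
   vanish. *)
have nKp : ~ K p by move=> /Ki ip; apply: nip; exact: mem_set.
by rewrite u0// mul0r add0r (grad_dot_support _ clK u0 nKp).
Qed.

End local_integration_by_parts.

(** * Bump functions of class C^1 *)

Section bump.
Context (R : realType) (n : nat).

(** The first-order remainder is at most [h ^+ 2] in absolute value, whatever the signs of [s] and
    [h + s], so the kink at 0 is covered too. *)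
Lemma is_derive_sqr_pos (s : R) :
  is_derive s 1 (fun t : R => Num.max t 0 ^+ 2) (2 * Num.max s 0).
Proof.
suff cl : h^-1 *: (Num.max (h%:A
    + s) 0 ^+ 2 - Num.max s 0 ^+ 2) @[h --> 0^'] --> 2 * Num.max s 0.
  by apply: DeriveDef; [apply/cvg_ex; eexists; exact: cl|exact: cvg_lim cl].
apply/cvgrPdist_le => e e0; near=> h.
have h0 : h != 0 by near: h; exact: nbhs_dnbhs_neq.
have he : `|h| <= e.
  by near: h; apply: dnbhs0_le.
apply: le_trans he; rewrite -(ler_pM2l (_ : 0 < `|h|)) ?normr_gt0// -normrM.
rewrite mulrBr /GRing.scale /= mulVKf// mulr1 -expr2 real_normK ?num_real//.
rewrite ler_norml; case: (leP s 0) => s0; case: (leP (h + s) 0) => hs0; apply/andP;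
    split; nra.
Unshelve. all: by end_near. Qed.

Lemma Cr_on_coord r (U : set 'rV[R]_n) (k : 'I_n) : Cr_on r U (fun x : 'rV[R]_n =>
    x 0 k).
Proof.
case: r => [|r]; first by move=> x _; exact: coord_continuous.
split=> [x _|j]; first exact: differentiable_coord.
rewrite (_ : partial j _ = fun=> (delta_mx 0 j : 'rV[R]_n) 0 k); first exact: Cr_on_cst.
apply/funext => x; rewrite /partial.
have dx : derivable (id : 'rV[R]_n -> 'rV[R]_n) x (delta_mx 0 j) by exact: derivable_id.
by rewrite -[in RHS](derive_id x (delta_mx 0 j)) derive_mx// mxE.
Qed.

(** Each factor is a squared positive part, which makes the product C^1; it vanishes outside the
    closed cube of half-side [r] around [x0]. *)
Definition bump (x0 : 'rV[R]_n) (r : R) (x : 'rV[R]_n) : R :=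
  \prod_k Num.max (r ^+ 2 - (x 0 k - x0 0 k) ^+ 2) 0 ^+ 2.

Lemma bump_ge0 x0 r x : 0 <= bump x0 r x.
Proof. by apply: prodr_ge0 => k _; exact: sqr_ge0. Qed.

Lemma bump_gt0 x0 r : 0 < r -> 0 < bump x0 r x0.
Proof.
move=> r0; apply: prodr_gt0 => k _; rewrite subrr expr0n subr0 exprn_gt0//.
by rewrite lt_max exprn_gt0.
Qed.

Lemma bump_out (x0 : 'rV[R]_n) r (x : 'rV[R]_n) k : 0 < r -> r < `|x 0 k - x0 0 k| ->
    bump x0 r x = 0.
Proof.
move=> r0 rx; rewrite /bump (bigD1 k)//= [Num.max _ _](_ : _ = 0) ?expr0n ?mul0r//.
apply/max_idPr; rewrite subr_le0 -[leRHS]real_normK ?num_real//.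
by rewrite lerXn2r ?nnegrE ?ltW// (lt_trans r0).
Qed.

Lemma Cr_on_bump x0 r : Cr_on 1 setT (bump x0 r).
Proof.
have oT : open [set: 'rV[R]_n] := openT.
apply: Cr_on_prod => // k _.
pose F (x : 'rV[R]_n) := r ^+ 2 - (x 0 k - x0 0 k) ^+ 2.
have CF : Cr_on 1 setT F.
  apply: (Cr_onD oT (Cr_on_cst _ _ _)); apply: (Cr_onN oT).
  have C : Cr_on 1 setT (fun x : 'rV[R]_n => x 0 k - x0 0 k).
    exact: (Cr_onD oT (Cr_on_coord _ _ _) (Cr_on_cst _ _ _)).
  exact: (Cr_onM oT C C).
have [dF CpF] := CF.
have H j x : differentiable ((fun t => Num.max t 0 ^+ 2) \o F) x /\
    partial j ((fun t => Num.max t 0 ^+ 2) \o F) x = (2 * Num.max (F x) 0)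
        * partial j F x.
  by apply: partial_comp1; [exact: dF|exact: is_derive_sqr_pos].
split=> [x _|j].
  apply: (@differentiable_comp _ _ _ _ F (fun t => Num.max t 0 ^+ 2)); first exact: dF.
  by apply/derivable1_diffP; have [] := is_derive_sqr_pos (F x).
apply: (@Cr_on_eq _ _ _ _ (fun x => (2 * Num.max (F x) 0) * partial j F x)) => //.
  by move=> x _; have [_ ->] := H j x.
apply: (Cr_onM oT); last exact: CpF.
apply: (Cr_onM oT (Cr_on_cst _ _ _)) => x _.
have cF : {for x, continuous F} by exact: (Cr_on_continuous CF).
exact: (continuous_max cF (@cst_continuous _ _ 0 x)).
Qed.

End bump.

(** * Chart independence of the weighted Laplacian and global integration by parts *)

Section global_integration_by_parts.
Context (R : realType) (n : nat) (M : ptopologicalType).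
Context (A : smooth_atlas R n M) (g : riemannian_metric A).
Context (vol : {measure set (borel M) ->
    \bar R}) (mu : probability (borel M) R) (V : M -> R).
Hypotheses (volP : is_riemannian_volume g vol) (smV : smooth_fun A V).
Hypothesis muE : forall B : set (borel M), measurable B ->
  mu B = (\int[vol]_(p in B) (expR (V p))%:E)%E.
Hypotheses (hausM : hausdorff_space M) (compactM : compact [set: M]).
Implicit Types (i j : chart A) (f h u : M -> R) (K : set M).

Lemma exists_bump i p (O : set M) : open O -> O p -> dom i p ->
  exists u K, [/\ compact K, K `<=` dom i `&` O, Cr_fun A 1 u,
    (forall q, ~ K q -> u q = 0) & (forall q, 0 <= u q) /\ 0 < u p].
Proof.
move=> oO Op ip; pose x0 := coord i p.
have : nbhs x0 (coord i @` (dom i `&` O)).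
  by apply: open_nbhs_nbhs; split; [exact: open_coord_image|exists p].
(* Halving the radius puts the closed cube [C], which is compact, inside the open ball of radius
   [e]. *)
move=> /nbhs_ballP[e /= e0 He]; pose r := e / 2; have r0 : 0 < r by rewrite divr_gt0.
pose C : set 'rV[R]_n := [set x | forall k, `[x0 0 k - r, x0 0 k + r]%classic (x 0 k)].
have cC : compact C.
  by apply: (@rV_compact _ _ (fun k => `[x0 0 k - r, x0 0 k + r]%classic)) => k;
      exact: segment_compact.
have CO : C `<=` coord i @` (dom i `&` O).
  move=> x Cx; apply: He; split=> // a k; rewrite ord1.
  have := Cx k; rewrite /= in_itv /= -ball_normE /= ltr_norml => /andP[? ?].
  have re : r < e by rewrite /r; lra.
  by apply/andP; split; lra.
have Ci : C `<=` cdom i by move=> x /CO[q [iq _] <-]; exact: cdom_coord.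
pose K := param i @` C.
have cK : compact K.
  apply: continuous_compact => //; apply: continuous_in_subspaceT => x /set_mem/Ci ix.
  exact: param_continuous.
have KO : K `<=` dom i `&` O.
  by move=> _ [x /CO[q [iq Oq] <-] <-]; rewrite coordK.
pose u q := if q \in dom i then bump x0 r (coord i q) else 0.
have u_in q : dom i q -> u q = bump x0 r (coord i q) by move=> iq; rewrite /u mem_set.
have u0 q : ~ K q -> u q = 0.
  move=> nKq; rewrite /u; case: ifPn => // /set_mem iq.
  have : ~ C (coord i q) by move=> Cq; apply: nKq; exists (coord i q) => //;
      rewrite coordK.
  move/existsNP => [k]; rewrite /= in_itv /= => /negP nC;
      apply: (bump_out (k := k)) => //.
  rewrite ltNge; apply: contra nC; rewrite ler_norml => /andP[? ?]; apply/andP; split;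
      lra.
exists u, K; split=> //.
(* In another chart [j], [u] is the bump composed with a transition map on the overlap with [dom i],
   and zero off the compact [K], closed because [M] is Hausdorff. *)
- move=> j; apply: Cr_on_local => x jx; have [ix|nix] := pselect (dom i (param j x)).
    have oji := @open_coord_image _ _ _ _ j _ (dom_open i).
    exists (coord j @` (dom j `&` dom i)); split=> //.
      by exists (param j x); [split=> //; exact: dom_param|rewrite paramK].
    apply: (Cr_on_eq oji (f := bump x0 r \o transition j i)).
      by move=> _ [q [jq iq] <-]; rewrite /local_expr /transition /= coordK// u_in.
    apply: (Cr_on_comp oji (W := setT)) => //; last exact: Cr_on_bump.
    by move=> c; exact: transition_Cr.
  have oK : open (~` K) by apply: closed_openC; exact: compact_closed.
  exists (coord j @` (dom j `&` ~` K)); split; first exact: open_coord_image.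
    exists (param j x); last by rewrite paramK.
    by split; [exact: dom_param|move=> /KO[]].
  apply: (Cr_on_eq (open_coord_image oK) _ (Cr_on_cst _ _ 0)).
  by move=> _ [q [jq nKq] <-]; rewrite /local_expr coordK// u0.
- split=> [q|]; last by rewrite u_in// bump_gt0.
  by rewrite /u; case: ifPn => // _; exact: bump_ge0.
Qed.

(* Tested against a bump, both sides integrate to minus the integral of the
   chart-independent [grad_dot]; this avoids differentiating Jacobians. *)
Lemma chart_laplacian_le i j p f : smooth_fun A f -> dom i p -> dom j p ->
  chart_laplacian g V i f (coord i p) <= chart_laplacian g V j f (coord j p).
Proof.
move=> sf ip jp; rewrite leNgt; apply/negP => lt.
pose D q := chart_laplacian g V i f (coord i q) - chart_laplacian g V j f (coord j q).
have cL k q : dom k q -> {for q, continuous (fun q =>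
    chart_laplacian g V k f (coord k q))}.
  move=> kq; apply: (continuous_at_coord (F := chart_laplacian g V k f) kq) => //.
  have C : Cr_on 0 (cdom k) (chart_laplacian g V k f) by apply: chart_laplacian_Cr;
      [exact: smV|exact: sf].
  exact/C/cdom_coord.
have cD : {for p, continuous D} by exact: (continuousB (cL i p ip) (cL j p jp)).
have nD : nbhs p [set q | 0 < D q] by apply: (cvgr_gt _ cD); rewrite subr_gt0.
(* [D] is meaningful only where both charts are defined; the bump will be supported there and where
   [D] is positive. *)
pose O := dom j `&` [set q | 0 < D q]°.
have oO : open O by apply: openI; [exact: dom_open|exact: open_interior].
have [u [K [cK KO Cu u0 [u_ge0 up]]]] := exists_bump oO (conj jp nD) ip.
have Ki : K `<=` dom i by move=> q /KO[].
have Kj : K `<=` dom j by move=> q /KO[_ []].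
have ci := continuous_chart_laplacian (g := g) smV hausM cK Ki u0 Cu sf.
have cj := continuous_chart_laplacian (g := g) smV hausM cK Kj u0 Cu sf.
have cuD : continuous (fun q => u q * D q).
  move=> q; under eq_fun do rewrite mulrBr.
  exact: (continuousB (ci q) (cj q)).
have uD0 q : 0 <= u q * D q.
  have [Kq|nKq] := pselect (K q); last by rewrite u0// mul0r.
  rewrite mulr_ge0// ltW//; have [_ [_ Dq]] := KO q Kq.
  exact: (interior_subset Dq).
have iD : \int[mu]_q (u q * D q) = 0.
  under eq_Rintegral do rewrite mulrBr.
  rewrite (RintegralB measurableT (integrable_continuous mu compactM ci)
      (integrable_continuous mu compactM cj)).
  rewrite (local_integration_by_parts volP smV muE hausM compactM cK Ki u0 Cu sf).
  rewrite (local_integration_by_parts volP smV muE hausM compactM cK Kj u0 Cu sf).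
  by rewrite subrr.
have := ge0_Rintegral_eq0 volP smV muE compactM cuD uD0 iD p.
by apply/eqP; rewrite mulf_neq0 ?gt_eqF// subr_gt0.
Qed.

(** From here on the chart at a point can be chosen freely, which gives the smoothness of [L f]. *)
Lemma weighted_laplacian_chart i p f : smooth_fun A f -> dom i p ->
  weighted_laplacian g V f p = chart_laplacian g V i f (coord i p).
Proof.
move=> sf ip; have jp := dom_chart_at A p.
by apply/eqP; rewrite eq_le weighted_laplacianE !chart_laplacian_le.
Qed.

Lemma smooth_weighted_laplacian f : smooth_fun A f ->
    smooth_fun A (weighted_laplacian g V f).
Proof.
move=> sf i r; have oi := @open_cdom _ _ _ _ i.
apply: (@Cr_on_eq _ _ _ _ (chart_laplacian g V i f)) => //.
  move=> x ix; rewrite /local_expr (weighted_laplacian_chart sf (dom_param ix)).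
  by rewrite paramK.
by apply: chart_laplacian_Cr; [exact: smV|exact: sf].
Qed.

Lemma smooth_grad_dot f h : smooth_fun A f -> smooth_fun A h ->
    smooth_fun A (grad_dot g f h).
Proof.
move=> sf sh i r; have oi := @open_cdom _ _ _ _ i.
apply: (@Cr_on_eq _ _ _ _ (dot g i f h)) => //.
  move=> x ix; have Cf := smooth_Cr_fun 1 sf; have Ch := smooth_Cr_fun 1 sh.
  by rewrite /local_expr (grad_dot_chart g Cf Ch (dom_param ix)) paramK.
by apply: dot_Cr; [exact: sf|exact: sh].
Qed.

Lemma grad_dotDr f u h : Cr_fun A 1 u -> Cr_fun A 1 h -> forall p,
  grad_dot g f (fun q => u q + h q) p = grad_dot g f u p + grad_dot g f h p.
Proof.
move=> Cu Ch p; rewrite !grad_dotE /dot -big_split /=; apply: eq_bigr => a _.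
set i := chart_at A p; have ip : cdom i (coord i p) by exact/cdom_coord/dom_chart_at.
have [du _] := Cu i; have [dh _] := Ch i.
by rewrite -mulrDr -(partialD a (du _ ip) (dh _ ip)).
Qed.

Lemma grad_dot_cst f (c : R) p : grad_dot g f (fun=> c) p = 0.
Proof.
rewrite grad_dotE; apply: big1 => a _.
by rewrite (_ : partial a _ _ = 0) ?mulr0// /partial /local_expr derive_cst.
Qed.

Lemma integration_by_parts f u : smooth_fun A f -> Cr_fun A 1 u ->
  \int[mu]_p (u p * weighted_laplacian g V f p) = - \int[mu]_p grad_dot g f u p.
Proof.
move=> sf Cu; pose L := weighted_laplacian g V f.
have cL : continuous L by exact/smooth_continuous/smooth_weighted_laplacian.
have Cf := smooth_Cr_fun 1 sf.
(* The C^1 test functions obeying the formula are stable under sums and contain those supported in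
   one chart; [u] will be written as a finite sum of the latter. *)
pose P v := Cr_fun A 1 v /\ \int[mu]_p (v p * L p) = - \int[mu]_p grad_dot g f v p.
have P0 : P (fun=> 0).
  split; first exact: Cr_fun_cst.
  rewrite (@eq_Rintegral _ _ _ mu setT (fun=> 0)); last by move=> p _; rewrite mul0r.
  rewrite [in RHS](@eq_Rintegral _ _ _ mu setT (fun=> 0)); last by move=> p _;
      rewrite grad_dot_cst.
  by rewrite Rintegral_cst// mul0r oppr0.
have PD v w : P v -> P w -> P (fun p => v p + w p).
  move=> [Cv Iv] [Cw Iw]; split; first exact: Cr_funD.
  have cvL k : Cr_fun A 1 k -> continuous (fun p => k p * L p).
    by move=> Ck p; apply: continuousM; [exact: (Cr_fun_continuous Ck)|exact: cL].
  rewrite (@eq_Rintegral _ _ _ mu setT (fun p => v p * L p + w p * L p)); last first.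
    by move=> p _; rewrite mulrDl.
  have iL k Ck := integrable_continuous mu compactM (cvL k Ck).
  have iG k Ck := integrable_continuous mu compactM (continuous_grad_dot (g := g) (f :=
      f) (u := k) Cf Ck).
  rewrite (RintegralD measurableT (iL v Cv) (iL w Cw)).
  rewrite Iv Iw [in RHS](@eq_Rintegral _ _ _ mu setT (fun p =>
      grad_dot g f v p + grad_dot g f w p)); last first.
    by move=> p _; rewrite grad_dotDr.
  by rewrite (RintegralD measurableT (iG v Cv) (iG w Cw)) opprD.
have bmp p : {uK : (M -> R) * set M | [/\ compact uK.2, uK.2 `<=` dom (chart_at A p),
    Cr_fun A 1 uK.1, (forall q, ~ uK.2 q ->
        uK.1 q = 0) & (forall q, 0 <= uK.1 q) /\ 0 < uK.1 p]}.
  apply: cid; have [v [K [cK Ki Cv vK v0]]] := exists_bump openT I (dom_chart_at A p).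
  by exists (v, K); split=> // q /Ki[].
pose b p := (sval (bmp p)).1.
have Cb p : Cr_fun A 1 (b p) by have [] := svalP (bmp p).
have b_ge0 p q : 0 <= b p q by have [_ _ _ _ [b0 _]] := svalP (bmp p); exact: b0.
(* The sets where the bumps are positive are open and cover [M]; compactness leaves finitely many of
   them. *)
have [D' _ cov] : finite_subset_cover [set: M] (fun p => [set q | 0 < b p q]) [set: M].
  move: compactM; rewrite compact_cover; apply.
    move=> p _; have cb : continuous (b p) := Cr_fun_continuous (Cb p).
    rewrite openE => q bq; exact: (cvgr_gt _ (cb q)).
  by move=> p _; exists p => //; have [_ _ _ _ []] := svalP (bmp p).
(* Dividing by [S] turns the bumps into a partition of unity. *)
pose S q := \sum_(p <- finmap.enum_fset D') b p q.
have CS : Cr_fun A 1 S by exact: Cr_fun_sum.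
have S0 q : S q != 0.
  have [p pD bp] := cov q I.
  have pD' : p \in finmap.enum_fset D' by [].
  rewrite gt_eqF// /S (big_rem p)//= ltr_wpDr//.
  by apply: sumr_ge0 => k _.
have Pb p : P (fun q => b p q * (u q * (S q)^-1)).
  have [cK Ki _ b0 _] := svalP (bmp p).
  have Cv : Cr_fun A 1 (fun q => b p q * (u q * (S q)^-1)).
    exact: (Cr_funM (Cb p) (Cr_funM Cu (Cr_funV CS S0))).
  split=> //; rewrite -(local_integration_by_parts volP smV muE hausM compactM cK Ki _
      Cv sf).
    apply: eq_Rintegral => q _; have [/Ki iq|nKq] := pselect ((sval (bmp p)).2 q).
      by rewrite /L (weighted_laplacian_chart sf iq).
    by rewrite /b b0// !mul0r.
  by move=> q nKq; rewrite /b b0// mul0r.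
pose v p q := b p q * (u q * (S q)^-1).
have Psum s : P (fun q => \sum_(p <- s) v p q).
  elim: s => [|p s IH].
    have -> : (fun q => \sum_(k <- [::]) v k q) = fun=> 0.
      by apply/funext => q; rewrite big_nil.
    exact: P0.
  have -> : (fun q => \sum_(k <- p :: s) v k q) = fun q => v p q + \sum_(k <- s) v k q.
    by apply/funext => q; rewrite big_cons.
  exact: (PD _ _ (Pb p) IH).
have E : (fun q => \sum_(p <- finmap.enum_fset D') v p q) = u.
  by apply/funext => q; rewrite -mulr_suml -/(S q) mulrC divfK.
by have := Psum (finmap.enum_fset D'); rewrite E => -[].
Qed.

End global_integration_by_parts.

(** * Calculus relative to an interval *)

Section interval_calculus.
Context (R : realType) (I : set R).
Hypotheses (Iitv : is_interval I) (Ind : exists a b, [/\ I a, I b & a < b]).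
Implicit Types (phi psi c P : R -> R) (x l : R).

(** Makes limits of difference quotients unique, so that [derive_within] is determined by
    [is_derive_within]. Non-degeneracy supplies a second point [d] of [I], and a short step from [x]
    towards [d] remains in [I]. *)
Lemma within_itv_proper x : I x -> ProperFilter (within (I `\ x) (nbhs x)).
Proof.
move=> Ix; have [a [b [Ia Ib ab]]] := Ind.
have [d Id dx] : exists2 d, I d & d != x.
  have [->|ax] := eqVneq x a; first by exists b => //; rewrite gt_eqF.
  by exists a => //; rewrite eq_sym.
apply: Build_ProperFilter_ex => B; rewrite /within /= => /nbhs_ballP[e /= e0 eB].
(* The step [t * (d - x)] has length at most [e / 2] and does not pass [d]. *)
pose t := Num.min 1 (e / 2 / `|d - x|).
have nd : 0 < `|d - x| by rewrite normr_gt0 subr_eq0.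
have t0 : 0 < t by rewrite lt_min ltr01 !divr_gt0.
have t1 : t <= 1 by rewrite ge_min lexx.
have te : t * `|d - x| < e.
  apply: (@le_lt_trans _ _ (e / 2)); last by rewrite ltr_pdivrMr// ltr_pMr// ltr1n.
  by rewrite -ler_pdivlMr// ge_min lexx orbT.
exists (x + t * (d - x)); apply: eB.
  by rewrite -ball_normE /= opprD addrA subrr sub0r normrN normrM gtr0_norm.
split; last first.
  move=> E; have : t * (d - x) = 0 by move: E; move: (t * _) => z; lra.
  by apply/eqP; rewrite mulf_eq0 subr_eq0 (negbTE dx) gt_eqF.
have [xd|dx'] := ltP x d.
  by apply: (Iitv Ix Id); apply/andP; split; nra.
by apply: (Iitv Id Ix); apply/andP; split; nra.
Qed.

Lemma derive_withinE phi x l : I x -> is_derive_within I phi x l ->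
  derive_within I phi x = l.
Proof. by move=> Ix dphi; have := within_itv_proper Ix => PF; exact: cvg_lim. Qed.

Lemma is_derive_within_eq phi psi x l : I x -> (forall y, I y -> phi y = psi y) ->
  is_derive_within I phi x l -> is_derive_within I psi x l.
Proof.
move=> Ix e /(is_derive_within_extension Ix)[xi [dxi xiI]].
by apply: (is_derive_is_derive_within Ix dxi) => y Iy; rewrite xiI// e.
Qed.

Lemma is_derive_withinV P x l : I x -> P x != 0 -> is_derive_within I P x l ->
  is_derive_within I (fun y => (P y)^-1) x (- l / P x ^+ 2).
Proof.
move=> Ix Px /(is_derive_within_extension Ix)[xi [[dxi <-] xiI]].
apply: (is_derive_is_derive_within (psi := fun y => (xi y)^-1) Ix); last first.
  by move=> y Iy; rewrite (xiI y Iy).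
have xi0 : xi x != 0 by rewrite xiI.
apply: DeriveDef; first exact: (derivableV xi0 dxi).
by rewrite (deriveV xi0 dxi) /GRing.scale /= (xiI x Ix) mulNr mulNr mulrC.
Qed.

Lemma is_derive_withinM P Q x l k : I x -> is_derive_within I P x l ->
  is_derive_within I Q x k ->
  is_derive_within I (fun y => P y * Q y) x (P x * k + l * Q x).
Proof.
move=> Ix /(is_derive_within_extension Ix)[xi [[dxi <-] xiI]].
move=> /(is_derive_within_extension Ix)[zeta [[dzeta <-] zetaI]].
apply: (is_derive_is_derive_within (psi := fun y => xi y * zeta y) Ix); last first.
  by move=> y Iy; rewrite (xiI y Iy) (zetaI y Iy).
apply: DeriveDef; first exact: (derivableM dxi dzeta).
by rewrite (deriveM dxi dzeta) /GRing.scale /= (xiI x Ix) (zetaI x Ix) [Q x * _]mulrC.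
Qed.

Lemma is_derive_withinN P x l : I x -> is_derive_within I P x l ->
  is_derive_within I (fun y => - P y) x (- l).
Proof.
move=> Ix /(is_derive_within_extension Ix)[xi [[dxi <-] xiI]].
apply: (is_derive_is_derive_within (psi := fun y => - xi y) Ix); last first.
  by move=> y Iy; rewrite (xiI y Iy).
by apply: DeriveDef; [exact: derivableN|exact: deriveN].
Qed.

Lemma derive_within2V P P1 P2 x : I x -> (forall y, I y -> P y != 0) ->
  (forall y, I y -> is_derive_within I P y (P1 y)) ->
  (forall y, I y -> is_derive_within I P1 y (P2 y)) ->
  is_derive_within I (derive_within I (fun y => (P y)^-1)) x
    (- P2 x / P x ^+ 2 + 2 * P1 x ^+ 2 / P x ^+ 3).
Proof.
move=> Ix P0 dP dP1; have Px := P0 x Ix.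
(* The first derivative is arranged as a product of functions already differentiated, so that the
   product rule alone yields the second. *)
apply: (@is_derive_within_eq (fun y => (-1 * P1 y) * ((P y)^-1 * (P y)^-1))) => //.
  move=> y Iy; rewrite (derive_withinE Iy (is_derive_withinV Iy (P0 y Iy) (dP y Iy))).
  by rewrite mulN1r expr2 invfM.
have dV := is_derive_withinV Ix Px (dP x Ix).
have dc : is_derive_within I (fun=> -1) x 0.
  by apply: (is_derive_is_derive_within (psi := fun=> -1) Ix) => //;
      exact: is_derive_cst.
have := is_derive_withinM Ix (is_derive_withinM Ix dc (dP1 x Ix))
    (is_derive_withinM Ix dV dV).
by congr is_derive_within; field.
Qed.

(** Convexity with weight [(w - v) / (w - u)], cleared of its denominator for the comparisons of
    slopes below. *)
Lemma convex_within_three c : convex_function (I : set R^o) (c : R^o -> R^o) ->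
  forall u v w, I u -> I w -> u < v -> v < w ->
  (w - u) * c v <= (w - v) * c u + (v - u) * c w.
Proof.
move=> cvx u v w Iu Iw uv vw; have uw : 0 < w - u by lra.
have t0 : 0 <= (w - v) / (w - u) by rewrite divr_ge0 ?ltW// subr_gt0.
have t1 : (w - v) / (w - u) <= 1 by rewrite ler_pdivrMr// mul1r; lra.
have := cvx (Itv01 t0 t1) u w (mem_set Iu) (mem_set Iw).
have E : (w - v) / (w - u) * u + (1 - (w - v) / (w - u)) * w = v by field;
    rewrite gt_eqF.
rewrite convRE [X in c X](_ : _ = v) /= /unstable.onem; last by rewrite -[RHS]E.
rewrite -(ler_pM2l uw) => /le_trans; apply.
by rewrite le_eqVlt; apply/orP; left; apply/eqP; field; rewrite gt_eqF.
Qed.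

Lemma is_derive_within_closed phi x l (C : set R) : closed C -> I x ->
  is_derive_within I phi x l ->
  (\forall y \near x, I y -> y != x -> C ((y - x)^-1 * (phi y - phi x))) -> C l.
Proof.
move=> cC Ix dphi H; have PF := within_itv_proper Ix.
apply: (closed_cvg (F := within (I `\ x) (nbhs x)) C cC _ _ dphi).
by rewrite /within /=; apply: filterS H => y H [Iy /eqP yx]; exact: H.
Qed.

Lemma is_derive_within_le phi x l k : I x -> is_derive_within I phi x l ->
  (\forall y \near x, I y -> y != x -> (y - x)^-1 * (phi y - phi x) <= k) -> l <= k.
Proof. exact: (is_derive_within_closed (C := [set z | z <= k]) (@closed_le _ k)). Qed.

Lemma is_derive_within_ge phi x l k : I x -> is_derive_within I phi x l ->
  (\forall y \near x, I y -> y != x -> k <= (y - x)^-1 * (phi y - phi x)) -> k <= l.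
Proof. exact: (is_derive_within_closed (C := [set z | k <= z]) (@closed_ge _ k)). Qed.

(** The slope of the chord from [x] to [y] separates the two derivatives: chords from [x] to points
    below [y] are at most as steep, and chords from [y] to points above [x] at least as steep. *)
Lemma convex_derive_le c c1 : convex_function (I : set R^o) (c : R^o -> R^o) ->
  (forall x, I x -> is_derive_within I c x (c1 x)) ->
  forall x y, I x -> I y -> x < y -> c1 x <= c1 y.
Proof.
move=> cvx dc x y Ix Iy xy.
have three := convex_within_three cvx.
apply: (@le_trans _ _ ((y - x)^-1 * (c y - c x))).
  apply: (is_derive_within_le Ix (dc x Ix)).
  have : \forall z \near x, z < y by exact: lt_nbhsl.
  apply: filterS => z zy Iz /=; rewrite neq_lt => /orP[zx|xz].
    have := three z x y Iz Iy zx xy => T.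
    (* The difference of the two slopes is the three-point inequality divided by a positive product;
       the other three cases have the same form. *)
    rewrite -subr_ge0 (_ : _ - _ = ((x - z) * (y - x))^-1 * ((y - x) * c z
        + (x - z) * c y - (y - z) * c x)).
      by rewrite mulr_ge0 ?subr_ge0// invr_ge0 mulr_ge0; lra.
    by field; apply/andP; split; lra.
  have := three x z y Ix Iy xz zy => T.
  rewrite -subr_ge0 (_ : _ - _ = ((z - x) * (y - x))^-1 * ((y - z) * c x
      + (z - x) * c y - (y - x) * c z)).
    by rewrite mulr_ge0 ?subr_ge0// invr_ge0 mulr_ge0; lra.
  by field; apply/andP; split; lra.
apply: (is_derive_within_ge Iy (dc y Iy)).
have : \forall z \near y, x < z by exact: lt_nbhsr.
apply: filterS => z xz Iz; rewrite neq_lt => /orP[zy|yz].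
  have := three x z y Ix Iy xz zy => T.
  rewrite -subr_ge0 (_ : _ - _ = ((y - z) * (y - x))^-1 * ((y - z) * c x
      + (z - x) * c y - (y - x) * c z)).
    by rewrite mulr_ge0 ?subr_ge0// invr_ge0 mulr_ge0; lra.
  by field; apply/andP; split; lra.
have := three x y z Ix Iz xy yz => T.
rewrite -subr_ge0 (_ : _ - _ = ((z - y) * (y - x))^-1 * ((z - y) * c x
    + (y - x) * c z - (z - x) * c y)).
  by rewrite mulr_ge0 ?subr_ge0// invr_ge0 mulr_ge0; lra.
by field; apply/andP; split; lra.
Qed.

Lemma convex_derive2_ge0 c c1 x l : convex_function (I : set R^o) (c : R^o -> R^o) ->
  (forall y, I y -> is_derive_within I c y (c1 y)) -> I x ->
  is_derive_within I c1 x l -> 0 <= l.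
Proof.
move=> cvx dc Ix dc1; apply: (is_derive_within_ge Ix dc1); near=> y => Iy.
rewrite neq_lt => /orP[yx|xy].
  have := convex_derive_le cvx dc Iy Ix yx => le.
  by rewrite -mulrNN mulr_ge0// ?oppr_ge0 ?invr_le0; lra.
have := convex_derive_le cvx dc Ix Iy xy => le.
by rewrite mulr_ge0// ?invr_ge0; lra.
Unshelve. all: by end_near. Qed.

Lemma smooth_within_is_derive phi r x : smooth_within I phi -> I x ->
  is_derive_within I (derive_within_n I r phi) x (derive_within_n I r.+1 phi x).
Proof. by move=> sphi Ix; exact: sphi. Qed.

(** The order [s] stays general in the induction on [r], because the chain rule replaces the
    derivative of order [s] by that of order [s.+1]. *)
Lemma Cr_on_comp_within n r s (U : set 'rV[R]_n) (f : 'rV[R]_n -> R) phi :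
  open U -> (forall y, I (f y)) -> (forall k, Cr_on k U f) -> smooth_within I phi ->
  Cr_on r U (derive_within_n I s phi \o f).
Proof.
move=> oU If Cf sphi.
have df (x : 'rV[R]_n) : U x -> differentiable f x by move=> Ux; have [d _] := Cf 1%N;
    exact: d.
have dc t (x : 'rV[R]_n) : U x -> differentiable (derive_within_n I t phi \o f) x.
  move=> Ux; apply: (differentiable_comp_within (l :=
      derive_within_n I t.+1 phi (f x)) If (df x Ux)).
  exact: (@smooth_within_is_derive phi t (f x) sphi (If x)).
elim: r s => [|r IH] s; first by move=> x Ux; exact/differentiable_continuous/dc.
split=> [x Ux|k]; first exact: dc.
apply: (Cr_on_eq (f := fun y : 'rV[R]_n =>
    derive_within_n I s.+1 phi (f y) * partial k f y) oU).
  move=> x Ux; rewrite (partial_comp_within k If (df x Ux)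
    (@smooth_within_is_derive phi s (f x) sphi (If x))) //.
apply: (Cr_onM oU); first exact: (IH s.+1).
by have [_ C] := Cf r.+1; exact: C.
Qed.

Lemma smooth_fun_comp_within n (M : ptopologicalType) (A : smooth_atlas R n M)
    (f : M -> R) phi s :
  smooth_fun A f -> (forall p, I (f p)) -> smooth_within I phi ->
  smooth_fun A (fun p => derive_within_n I s phi (f p)).
Proof.
move=> sf If sphi i r; have oi := @open_cdom _ _ _ _ i.
apply: (Cr_on_comp_within r s (f := local_expr i f) oi).
- by move=> y; exact: (If (param i y)).
- by move=> k; exact: (sf i k).
- exact: sphi.
Qed.

End interval_calculus.

(** * The integral curvature-dimension condition *)

Section gradient_comp.
Context (R : realType) (n : nat) (M : ptopologicalType).
Context (A : smooth_atlas R n M) (g : riemannian_metric A).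
Context (I : set R) (phi : R -> R) (f : M -> R).
Hypotheses (sf : smooth_fun A f) (If : forall p, I (f p)) (sphi : smooth_within I phi).

Lemma partial_local_expr_comp s (i : chart A) a (x : 'rV[R]_n) : cdom i x ->
  partial a (local_expr i (fun p => derive_within_n I s phi (f p))) x =
  derive_within_n I s.+1 phi (local_expr i f x) * partial a (local_expr i f) x.
Proof.
move=> ix; have [df _] := sf i 1; have dfx := df x ix.
apply: (partial_comp_within a _ dfx).
  by move=> y; exact: (If (param i y)).
by apply: smooth_within_is_derive; [exact: sphi|exact: If].
Qed.

Lemma grad_dot_compr s h p : grad_dot g h (fun q => derive_within_n I s phi (f q)) p =
  derive_within_n I s.+1 phi (f p) * grad_dot g h f p.
Proof.
rewrite !grad_dotE /dot mulr_sumr; apply: eq_bigr => a _.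
have ip := dom_chart_at A p.
rewrite (partial_local_expr_comp s a (cdom_coord ip)) -(local_exprK f ip).
by rewrite mulrCA.
Qed.

Lemma grad_dotC h k p : grad_dot g h k p = grad_dot g k h p.
Proof. by rewrite !grad_dotE; apply: dotC; exact/cdom_coord/dom_chart_at. Qed.

Lemma grad_dot_compl s h p : grad_dot g (fun q => derive_within_n I s phi (f q)) h p =
  derive_within_n I s.+1 phi (f p) * grad_dot g f h p.
Proof. by rewrite grad_dotC grad_dot_compr grad_dotC. Qed.

End gradient_comp.

Theorem proposition1p4 (R : realType) (n : nat) (M : ptopologicalType)
    (A : smooth_atlas R n M) (g : riemannian_metric A)
    (vol : {measure set (borel M) -> \bar R})
    (mu : probability (borel M) R)
    (V : M -> R) (I : set R) (Phi : R -> R) (K m : R) :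
  hausdorff_space M ->
  compact [set: M] ->
  is_riemannian_volume g vol ->
  smooth_fun A V ->
  (forall B : set (borel M), measurable B ->
     mu B = (\int[vol]_(p in B) (expR (V p))%:E)%E) ->
  admissible I Phi ->
  0 < m ->
  let L := weighted_laplacian g V in
  let Phi1 := derive_within_n I 1 Phi in
  let Phi2 := derive_within_n I 2 Phi in
  (forall f : M -> R, smooth_fun A f -> forall p : M,
     Gamma2 L f f p >= K * Gamma L f f p + m^-1 * (L f p) ^+ 2) ->
  forall f : M -> R, smooth_fun A f -> (forall p : M, I (f p)) ->
    \int[mu]_p
      (2 * Gamma2 L (fun q => Phi1 (f q)) (fun q => Phi1 (f q)) p / Phi2 (f p)
       - derive_within_n I 2 (fun x => (Phi2 x)^-1) (f p)
         * (Phi2 (f p) * Gamma L f f p) ^+ 2)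
    >= 2 * K * q_Phi mu L I Phi f
       + 2 * (q_Phi mu L I Phi f) ^+ 2 / (m * C_Phi mu I Phi f).
Proof.
move=> hausM compactM volP smV muE [Iitv Ind sPhi _ Phi2_gt0 _ cvxV] m0 L Phi1 Phi2 CD
    f sf If.
pose h q := Phi1 (f q); pose P q := Phi2 (f q).
pose P3 q := derive_within_n I 3 Phi (f q); pose P4 q := derive_within_n I 4 Phi (f q).
have sh : smooth_fun A h by exact: (smooth_fun_comp_within 1 sf If sPhi).
have sP : smooth_fun A P by exact: (smooth_fun_comp_within 2 sf If sPhi).
have sP3 : smooth_fun A P3 by exact: (smooth_fun_comp_within 3 sf If sPhi).
have sP4 : smooth_fun A P4 by exact: (smooth_fun_comp_within 4 sf If sPhi).
have P0 q : 0 < P q by exact: Phi2_gt0.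
have Pn0 q : P q != 0 by rewrite gt_eqF.
pose G p := Gamma L f f p; pose N p := derive_within_n I 2 (fun x => (Phi2 x)^-1) (f p).
have GE : G = grad_dot g f f by apply/funext => p; exact: Gamma_grad_dot.
have sL k : smooth_fun A k -> smooth_fun A (L k).
  exact: (smooth_weighted_laplacian volP smV muE hausM compactM).
have sG k l : smooth_fun A k -> smooth_fun A l -> smooth_fun A (Gamma L k l).
  move=> sk sl; rewrite (_ : Gamma L k l = grad_dot g k l);
      first exact: smooth_grad_dot.
  by apply/funext => p; exact: Gamma_grad_dot.
have GhE p : Gamma L h h p = P p ^+ 2 * G p.
  rewrite (Gamma_grad_dot g smV p sh sh) GE (grad_dot_compr g sf If sPhi)
      (grad_dot_compl g sf If sPhi).
  by rewrite mulrA expr2.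
have dV y : I y -> is_derive_within I (derive_within I (fun x => (Phi2 x)^-1)) y
    (- derive_within_n I 4 Phi y / Phi2 y ^+ 2
        + 2 * derive_within_n I 3 Phi y ^+ 2 / Phi2 y ^+ 3).
  move=> Iy; apply: (derive_within2V Iitv Ind Iy).
  - by move=> z Iz; rewrite gt_eqF// Phi2_gt0.
  - by move=> z Iz; exact: (@smooth_within_is_derive R I Phi 2 z sPhi Iz).
  - by move=> z Iz; exact: (@smooth_within_is_derive R I Phi 3 z sPhi Iz).
(* This formula yields the continuity of [N]; its sign comes instead from the convexity of
   [-1 / Phi2]. *)
have NE p : N p = - P4 p * (P p ^+ 2)^-1 + 2 * P3 p ^+ 2 * (P p ^+ 3)^-1.
  exact: (derive_withinE Iitv Ind (If p) (dV _ (If p))).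
have N_le0 p : N p <= 0.
  rewrite -oppr_ge0.
  have dinv y : I y -> is_derive_within I (fun x => (Phi2 x)^-1) y
      (derive_within I (fun x => (Phi2 x)^-1) y).
    move=> Iy; have y0 : Phi2 y != 0 by rewrite gt_eqF// Phi2_gt0.
    have d := is_derive_withinV Iy y0 (@smooth_within_is_derive R I Phi 2 y sPhi Iy).
    by rewrite (derive_withinE Iitv Ind Iy d).
  apply: (convex_derive2_ge0 Iitv Ind cvxV _ (If p)) => [y Iy|].
    exact: (is_derive_withinN Iy (dinv y Iy)).
  by apply: (is_derive_withinN (If p)); rewrite NE; exact: dV.
have intC a : Cr_fun A 0 a -> mu.-integrable setT (EFin \o (a : borel M -> R)).
  by move=> Ca; exact: (integrable_continuous mu compactM (Cr_fun_continuous Ca)).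
have Cc c : Cr_fun A 0 (fun=> c) by exact: Cr_fun_cst.
have Cf := smooth_Cr_fun 0 sf; have CP := smooth_Cr_fun 0 sP.
have CG := smooth_Cr_fun 0 (sG f f sf sf); have CLh := smooth_Cr_fun 0 (sL h sh).
have CPV k : Cr_fun A 0 (fun p => (P p ^+ k)^-1).
  by apply: (Cr_funV (Cr_funX k CP)) => p; rewrite expf_neq0.
have CPG : Cr_fun A 0 (fun p => P p * G p) := Cr_funM CP CG.
have CLP : Cr_fun A 0 (fun p => (L h p) ^+ 2 * (P p)^-1) :=
  Cr_funM (Cr_funX 2 CLh) (CPV 1%N).
have CfL : Cr_fun A 0 (fun p => f p * L h p) := Cr_funM Cf CLh.
have CfP : Cr_fun A 0 (fun p => f p ^+ 2 * P p) := Cr_funM (Cr_funX 2 Cf) CP.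
have CN : Cr_fun A 0 N.
  have -> : N = fun p => - P4 p * (P p ^+ 2)^-1 + 2 * P3 p ^+ 2 * (P p ^+ 3)^-1.
    exact/funext.
  exact: (Cr_funD (Cr_funM (Cr_funN (smooth_Cr_fun 0 sP4)) (CPV 2))
    (Cr_funM (Cr_funM (Cc 2) (Cr_funX 2 (smooth_Cr_fun 0 sP3))) (CPV 3))).
have CG2 : Cr_fun A 0 (Gamma2 L h h).
  have CLG := smooth_Cr_fun 0 (sL _ (sG _ _ sh sh)).
  have CGL := smooth_Cr_fun 0 (sG _ _ (sL _ sh) sh).
  have CGL' := smooth_Cr_fun 0 (sG _ _ sh (sL _ sh)).
  exact: (Cr_funM (Cc 2^-1) (Cr_funD (Cr_funD CLG (Cr_funN CGL)) (Cr_funN CGL'))).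
pose F p := 2 * Gamma2 L h h p * (P p)^-1 - N p * (P p * G p) ^+ 2.
have CF : Cr_fun A 0 F :=
  Cr_funD (Cr_funM (Cr_funM (Cc 2) CG2) (CPV 1%N)) (Cr_funN (Cr_funM CN
      (Cr_funX 2 CPG))).
set q := q_Phi mu L I Phi f; set C := C_Phi mu I Phi f.
pose D := \int[mu]_p ((L h p) ^+ 2 * (P p)^-1).
have ibp : \int[mu]_p (f p * L h p) = - q.
  rewrite (integration_by_parts volP smV muE hausM compactM sh (smooth_Cr_fun 1 sf)).
  congr (- _); apply: eq_Rintegral => p _.
  by rewrite (grad_dot_compl g sf If sPhi) -GE.
have D0 : 0 <= D.
  by apply: Rintegral_ge0 => p _; rewrite mulr_ge0 ?sqr_ge0// invr_ge0 ltW.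
(* The integral of [(L h - t P f)^2 / P]; minimizing over [t] gives
   Cauchy-Schwarz without square roots. *)
have quad t : 0 <= D + 2 * t * q + t ^+ 2 * C.
  have intfL := intC _ (Cr_funM (Cc (- (2 * t))) CfL).
  have intfP := intC _ (Cr_funM (Cc (t ^+ 2)) CfP).
  have -> : D + 2 * t * q + t ^+ 2 * C =
      \int[mu]_p ((L h p) ^+ 2 * (P p)^-1 + (- (2 * t)) * (f p * L h p) +
                  t ^+ 2 * (f p ^+ 2 * P p)).
    rewrite (RintegralD measurableT _ intfP); last first.
      exact: intC (Cr_funD CLP (Cr_funM (Cc (- (2 * t))) CfL)).
    rewrite (RintegralD measurableT (intC _ CLP) intfL).
    rewrite (RintegralZl _ measurableT (intC _ CfL)).
    by rewrite (RintegralZl _ measurableT (intC _ CfP)) ibp mulrNN.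
  apply: Rintegral_ge0 => p _.
  have -> : (L h p) ^+ 2 * (P p)^-1 + - (2 * t) * (f p * L h p)
      + t ^+ 2 * (f p ^+ 2 * P p) =
      (L h p - t * (P p * f p)) ^+ 2 * (P p)^-1.
    have := Pn0 p; move: (L h p) (P p) (f p) => a b c b0; by field.
  by rewrite mulr_ge0 ?sqr_ge0// invr_ge0 ltW.
have cauchy : q ^+ 2 / C <= D.
  (* If [C = 0], the quotient is 0 by the convention on inverses and the claim is [D0]. *)
  have [C_0|C_n0] := eqVneq C 0; first by rewrite C_0 invr0 mulr0.
  (* The left side is the value of the quadratic polynomial at its minimizer [t = - q / C]. *)
  have E : D - q ^+ 2 / C = D + 2 * (- q / C) * q + (- q / C) ^+ 2 * C by field.
  by rewrite -subr_ge0 E.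
(* The term in [N] has a favourable sign and is dropped. Dividing by [P] leaves one of the two
   factors [P] of [Gamma L h h], which gives the integrand of [q]. *)
have FB p : 2 * K * (P p * G p) + 2 / m * ((L h p) ^+ 2 * (P p)^-1) <= F p.
  have := CD h sh p; rewrite GhE => H.
  have NG : 0 <= - (N p * (P p * G p) ^+ 2)
      by rewrite -mulNr mulr_ge0 ?sqr_ge0// oppr_ge0.
  apply: (@le_trans _ _ (2 * Gamma2 L h h p * (P p)^-1)); last by rewrite lerDl.
  have -> : 2 * K * (P p * G p) + 2 / m * (L h p ^+ 2 * (P p)^-1) =
      2 * (K * (P p ^+ 2 * G p) + m^-1 * L h p ^+ 2) * (P p)^-1.
    have := Pn0 p; have := gt_eqF m0; move: (L h p) (P p) (G p) => a b c.
    by move=> m_n0 b0; field; rewrite b0 m_n0.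
  by rewrite ler_pM2r ?invr_gt0// ler_pM2l.
(* [invfM] also holds at zero, so splitting the inverse of [m * C] respects the convention for
   [C = 0]. *)
have -> : 2 * K * q + 2 * q ^+ 2 / (m * C) = 2 * K * q + 2 / m * (q ^+ 2 / C).
  by rewrite invfM; ring.
apply: (@le_trans _ _ (2 * K * q + 2 / m * D)).
  by rewrite lerD2l ler_pM2l// divr_gt0.
have intPG := intC _ (Cr_funM (Cc (2 * K)) CPG).
have intLP := intC _ (Cr_funM (Cc (2 / m)) CLP).
have -> : 2 * K * q + 2 / m * D =
    \int[mu]_p (2 * K * (P p * G p) + 2 / m * ((L h p) ^+ 2 * (P p)^-1)).
  rewrite (RintegralD measurableT intPG intLP).
  rewrite (RintegralZl _ measurableT (intC _ CPG)).
  by rewrite (RintegralZl _ measurableT (intC _ CLP)).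
apply: (le_Rintegral measurableT _ (intC _ CF)); last by move=> p _; exact: FB.
exact: intC (Cr_funD (Cr_funM (Cc (2 * K)) CPG) (Cr_funM (Cc (2 / m)) CLP)).
Qed.
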